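(* Fix integers $2\le r\le k$. There is a randomized one-pass streaming algorithm with the following guarantee. Given integers $n\ge 2$ and $$1\le \Delta\le \max\left\{1,\sum_{q=r}^{k}\binom{n-1}{q-1}\right\},$$ and a duplicate-free insertion-only stream describing an $n$-vertex hypergraph $H$ of maximum degree at most $\Delta$, where every edge size belongs to $\{r,r+1,\ldots,k\}$, the algorithm with high probability outputs a proper coloring of $H$ with $$O_{r,k}\left(\Delta^{1/(r-1)}\right)$$ colors. It uses $\widetilde O_{r,k}(n)$ bits of working memory and has expected polynomial postprocessing time.
   Context: A hypergraph $H=(V,E)$ consists of a finite vertex set and a set $E$ of subsets of $V$ (edges). A proper coloring assigns a color to each vertex so that no edge is monochromatic. The degree of a vertex is the number of edges containing it, and the maximum degree is the maximum over all vertices. Streaming model (insertion-only, one pass): the algorithm is given $n,r,k,\Delta$ in advance. Edges arrive one at a time, each given by the identifiers of its distinct vertices; no edge is repeated or deleted, and the algorithm sees each edge only once. The order of the stream is fixed independently of the algorithm's random choices. After the last edge the algorithm performs computation (postprocessing) and outputs the coloring; the memory used in postprocessing is included in the space bound. Space is measured in bits. $O_{r,k}(\cdot)$ hides constants depending only on $r,k$; $\widetilde O_{r,k}(\cdot)$ suppresses factors that are fixed powers of $\log n$ (exponent possibly depending on $r,k$) and constants depending on $r,k$. ''With high probability'' means with probability at least $1-n^{-c}$ for some constant $c>0$, over the algorithm's random choices. *)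

(* Defs.v *)
(* MathComp / MathComp-Analysis *)
From HB Require Import structures.
From mathcomp Require Import all_boot all_order all_algebra.
From mathcomp Require Import all_classical all_reals all_analysis.

Set Implicit Arguments.
Unset Strict Implicit.
Unset Printing Implicit Defensive.

Local Open Scope nat_scope.

Section Hypergraph.
Context {V : finType}.
Implicit Types (H : {set {set V}}).

Definition degree H (v : V) : nat := #|[set e in H | v \in e]%SET|.

Definition max_degree H : nat := \max_(v : V) degree H v.

Definition monochromatic (f : V -> nat) (e : {set V}) : Prop :=
  exists c : nat, forall v, v \in e -> f v = c.

Definition proper_coloring H (f : V -> nat) : Prop :=
  forall e, e \in H -> ~ monochromatic f e.

(* Each edge arrives as a list of its distinct vertices, in any order;
   [perm_eq] makes the stream list every edge of H exactly once. *)
Definition stream_of H (s : seq (seq V)) : bool :=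
  all uniq s && perm_eq [seq [set:: e]%SET | e <- s] (enum H).

End Hypergraph.

(* Machine model: a logarithmic-cost random-access machine, programmed with
   structured commands. Its only read/write storage is a list of natural
   numbers, the cell at address i being entry i of the list; writing past the
   end allocates all the cells in between. *)

Inductive binop := OpAdd | OpSub | OpMul | OpDiv | OpMod | OpLeq | OpEq.

Definition binop_sem (o : binop) : nat -> nat -> nat :=
  match o with
  | OpAdd => addn
  | OpSub => subn
  | OpMul => muln
  | OpDiv => divn
  | OpMod => modn
  | OpLeq => fun x y => nat_of_bool (x <= y)
  | OpEq => fun x y => nat_of_bool (x == y)
  end.

(* [EdgeSize] and [EdgeVertex] read the edge that is currently being
   processed; no other part of the stream is accessible. *)
Inductive expr :=
| Const of nat
| Cell of expr
| EdgeSize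
| EdgeVertex of expr
| BinOp of binop & expr & expr.

(* [Assign a e] writes e at address a, [Flip a] writes a fresh random bit at
   address a, and [Emit e] appends e to a write-only output. *)
Inductive cmd :=
| Skip
| Assign of expr & expr
| Flip of expr
| Emit of expr
| Then of cmd & cmd
| If of expr & cmd & cmd
| While of expr & cmd.

Definition bits (x : nat) : nat := (trunc_log 2 x).+1.

Definition total_bits (s : seq nat) : nat := \sum_(x <- s) bits x.

Section Expressions.
Variables (mem edge : seq nat).

Fixpoint eval (e : expr) : nat :=
  match e with
  | Const c => c
  | Cell a => nth 0 mem (eval a)
  | EdgeSize => size edge
  | EdgeVertex i => nth 0 edge (eval i)
  | BinOp o e1 e2 => binop_sem o (eval e1) (eval e2)
  end.

(* Total length of all addresses, operands and results occurring in the
   evaluation of an expression. *)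
Fixpoint eval_bits (e : expr) : nat :=
  bits (eval e) +
  match e with
  | Const _ | EdgeSize => 0
  | Cell a => eval_bits a
  | EdgeVertex i => eval_bits i
  | BinOp _ e1 e2 => eval_bits e1 + eval_bits e2
  end.

Definition cmd_bits (c : cmd) : nat :=
  match c with
  | Skip | Then _ _ => 0
  | Assign a e => eval_bits a + eval_bits e
  | Flip a => eval_bits a
  | Emit e => eval_bits e
  | If e _ _ | While e _ => eval_bits e
  end.

End Expressions.

(* [on_start] runs before the stream, [on_edge] once on each arriving edge,
   and [on_end] is the postprocessing; the memory persists throughout. *)
Record algorithm := Algorithm { on_start : cmd; on_edge : cmd; on_end : cmd }.

(* [code] is the list of commands still to be executed in the current phase.
   Its depth and its entries are bounded in terms of the program alone, so the
   control state takes O(1) bits. *)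
Record config := Config {
  code : seq cmd;
  post : bool;                (* the stream is over: postprocessing *)
  future : seq (seq nat);     (* edges that have not arrived yet *)
  edge : seq nat;             (* the edge being processed *)
  memory : seq nat;
  coins_used : nat;
  output : seq nat
}.

Section Semantics.
Variables (A : algorithm) (coin : nat -> bool).

Definition exec (i : cmd) (k : seq cmd) (c : config) : config :=
  let: Config _ p fut ed m nc out := c in
  let ev := eval m ed in
  match i with
  | Skip => Config k p fut ed m nc out
  | Assign a e => Config k p fut ed (set_nth 0 m (ev a) (ev e)) nc out
  | Flip a =>
      Config k p fut ed (set_nth 0 m (ev a) (nat_of_bool (coin nc))) nc.+1 out
  | Emit e => Config k p fut ed m nc (rcons out (ev e))
  | Then i1 i2 => Config (i1 :: i2 :: k) p fut ed m nc out
  | If e i1 i2 =>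
      Config ((if ev e != 0 then i1 else i2) :: k) p fut ed m nc out
  | While e i1 =>
      Config (if ev e != 0 then i1 :: i :: k else k) p fut ed m nc out
  end.

Definition step (c : config) : config :=
  match code c with
  | i :: k => exec i k c
  | [::] =>
      if post c then c else
      match future c with
      | e :: es =>
          Config [:: on_edge A] false es e (memory c) (coins_used c) (output c)
      | [::] =>
          Config [:: on_end A] true [::] [::] (memory c) (coins_used c)
                 (output c)
      end
  end.

Definition run (init : seq nat) (s : seq (seq nat)) (t : nat) : config :=
  iter t step (Config [:: on_start A] false s [::] init 0 [::]).

End Semantics.

Definition halted (c : config) : bool := post c && nilp (code c).

Definition scratch_bits (c : config) : nat :=
  if code c is i :: _ then cmd_bits (memory c) (edge c) i else 0.

(* The output is write-only and the random bits are read-once, so neither is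
   part of the working memory; temporaries and the current edge are. *)
Definition space_used (c : config) : nat :=
  total_bits (memory c) + total_bits (edge c) + scratch_bits c.

Definition step_time (c : config) : nat :=
  if halted c then 0 else (scratch_bits c).+1.

(* The run on an n-vertex stream, with the four parameters in cells 0..3. *)
Definition stream_run (A : algorithm) (n r k Delta : nat)
    (s : seq (seq 'I_n)) (coin : nat -> bool) (t : nat) : config :=
  run A coin [:: n; r; k; Delta] [seq [seq val v | v <- e] | e <- s] t.

(* The output is a list of n colors, that of vertex v being its entry v. *)
Definition outputs_coloring (n : nat) (H : {set {set 'I_n}}) (q : nat)
    (c : config) : Prop :=
  [/\ halted c, size (output c) = n,
      forall v : 'I_n, nth 0 (output c) v < q
    & proper_coloring H (fun v : 'I_n => nth 0 (output c) v)].

Section Randomness.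
Context {d : measure_display} {T : measurableType d} {R : realType}.
Variable P : probability T R.
Local Open Scope classical_set_scope.

(* A sequence of independent, uniformly distributed random bits. *)
Definition fair_coins (coin : nat -> T -> bool) : Prop :=
  (forall i, measurable [set w | coin i w]) /\
  (forall (m : nat) (b : m.-tuple bool),
     P [set w | forall i : 'I_m, coin i w = tnth b i]
     = ((2%:R^-1 ^+ m)%R : R)%:E).

End Randomness.

(* Postprocessing time of a run, infinite when the run does not halt. *)
Definition post_time (R : realType) (c : nat -> config) : \bar R :=
  if `[< exists t, halted (c t) >] then
    (\sum_(0 <= t <oo) ((if post (c t) then step_time (c t) else 0)%:R : R)%:E)%E
  else +oo%E.

(* Main.v *)
Require Import Defs.
From HB Require Import structures.
From mathcomp Require Import all_boot zify.
From mathcomp Require boolp.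

Set Implicit Arguments.
Unset Strict Implicit.
Unset Printing Implicit Defensive.

(** The palette of about [Delta ^ (1 / r.-1)] colors is cut into [l] blocks, with
    [l] at most of order [log n]. Before the stream, each vertex picks one uniformly random
    color in each block, so that only [l] colors per vertex remain possible and the
    rest of the work is to choose a block for each vertex. An edge can only become
    monochromatic through a block in which its first [r] vertices picked the same
    color; such a pair of an edge and a block is called an event below, and only
    events are stored.

    In a given block, the number of events at a vertex (its load) has expectation at
    most [Delta] divided by the [r.-1]-th power of the block size, which is a small
    constant times [l ^ r.-1]. A pair of a vertex and a block whose load exceeds
    [cap], a fixed multiple of this expectation, is crowded: it is never used, and
    its further events are not stored. This bounds the memory by [n * l * cap] events
    whatever the coins. By Markov's inequality a pair is crowded with a tiny
    probability ([crowded_rare]), and the blocks of a vertex are independent, so with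
    high probability no vertex has more than an eighth of its blocks crowded
    ([crowd_card], [crowd_rare]).

    What remains is a list coloring problem on [n] vertices with [l] choices each,
    and at most [cap] events, all of size [r], for each vertex and choice. It is in
    the regime of the local lemma, and is solved by backtracking: repeatedly pick a
    uniformly random block for the least blank vertex and, if this completes a stored
    event, erase the colors of all the vertices of that event. The analysis
    ([search_bound]) is by counting rather than by dependency: for a fixed sequence of
    outcomes (block refused, kept, or the given event erased), each attempt is an
    injective map on partial colorings, so summing over all partial colorings with
    the same blank vertices gives a recursion in the number of blank vertices alone.
    Its solution shows that the search is unfinished after [10 * n] attempts with
    probability at most [8 ^ (- n)]. So both the running time and the memory are bounded
    for all coins, and only the properness of the coloring is random.

    The random choices have ranges that are powers of two, hence are in bijection
    with coin sequences ([unlucky_rare]). The program itself is verified with a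
    weakest-precondition calculus ([wp]) that also bounds the number of steps and, at
    all intermediate configurations, the number and size of the memory cells
    ([stream_run_spec]). *)

Local Open Scope nat_scope.

(** * Counting lemmas *)

Lemma leq_sum_inj (I J : finType) (P : pred I) (Q : pred J) (h : I -> J)
    (G : J -> nat) :
  {in P &, injective h} -> (forall i, P i -> Q (h i)) ->
  \sum_(i | P i) G (h i) <= \sum_(j | Q j) G j.
Proof.
move=> hinj PQ; rewrite -(big_imset G hinj).
rewrite [leqLHS]big_mkcond [leqRHS]big_mkcond leq_sum // => j _.
by case: imsetP => // -[i Pi ->]; rewrite PQ.
Qed.

Lemma card_consE (C : finType) (T : nat) (Q : seq C -> bool) :
  #|[pred cs : T.+1.-tuple C | Q cs]|
  = \sum_(c : C) #|[pred cs : T.-tuple C | Q (c :: cs)]|.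
Proof.
rewrite -sum1_card.
under [RHS]eq_bigr do rewrite -sum1_card.
rewrite pair_big_dep /=.
rewrite (reindex (fun p : C * T.-tuple C => [tuple of p.1 :: p.2])) //=.
exists (fun t : T.+1.-tuple C => (thead t, [tuple of behead t])).
  move=> [c cs] _ /=; congr (_, _); exact: val_inj.
by move=> t _; rewrite /= -tuple_eta.
Qed.

(** * Backtracking search for a list coloring *)

Section Search.
Variables (V C : finType) (r D : nat) (ban : V -> C -> bool).
Variables (evs : seq (seq V * C)) (next : {set V} -> option V).

Notation partial := {ffun V -> option C}.
Implicit Types (x y : partial) (E : seq V * C) (U : {set V}).

Definition violated x E := all (fun u => x u == Some E.2) E.1.
Definition erase x (e : seq V) : partial :=
  [ffun u => if u \in e then None else x u].
Definition paint x v c : partial := [ffun u => if u == v then Some c else x u].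
Definition blank x : {set V} := [set u | x u == None]%SET.
Definition place x c : partial :=
  if next (blank x) is Some v then if ban v c then x else paint x v c else x.
(** One left-to-right pass, each event being tested on the coloring left by the
    previous ones. If all violated events share a vertex, erasing the first of
    them satisfies the others, so that a single event is ever erased. *)
Definition repair x : partial :=
  foldl (fun z E => if violated z E then erase z E.1 else z) x evs.
Definition attempt x c : partial := repair (place x c).
Definition search x (cs : seq C) : partial := foldl attempt x cs.
Definition legal x := all (fun E => ~~ violated x E) evs.
Definition unfinished T x : nat :=
  #|[pred cs : T.-tuple C | blank (search x cs) != set0]|.

Hypothesis next_some : forall U v, next U = Some v -> v \in U.
Hypothesis next_none : forall U, next U = None -> U = set0.
Hypothesis r_gt0 : 0 < r.
Hypothesis evs_uniq : forall E, E \in evs -> uniq E.1 && (size E.1 == r).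

Lemma violated_mem x E v : violated x E -> v \in E.1 -> x v = Some E.2.
Proof. by move=> /allP h /h /eqP. Qed.

Lemma violated_erase x e E : violated (erase x e) E -> violated x E.
Proof.
move=> /allP h; apply/allP => u /h; rewrite ffunE; by case: ifP.
Qed.

Lemma repair_legal x : legal x -> repair x = x.
Proof.
rewrite /repair /legal; elim: evs => //= E s IH /andP[/negbTE -> h]; exact: IH.
Qed.

(** The vertex [v] is the one just painted: a pass erases at most one event,
    since erasing it leaves [v] blank and so satisfies every other one. *)
Lemma repair_foldl (s : seq (seq V * C)) v x :
  (forall E, E \in s -> violated x E -> v \in E.1) ->
  let y := foldl (fun z E => if violated z E then erase z E.1 else z) x s in
  (all (fun E => ~~ violated x E) s /\ y = x) \/
  (exists2 E, E \in s & violated x E /\ y = erase x E.1).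
Proof.
elim: s x => [|E s IH] x hs /=; first by left.
have hs' : forall E', E' \in s -> violated x E' -> v \in E'.1.
  by move=> E' h; apply: hs; rewrite inE h orbT.
case: ifP => vE /=.
  right; exists E; first by rewrite mem_head.
  split => //.
  have Ev : v \in E.1 by apply: hs => //; rewrite mem_head.
  have : all (fun E' => ~~ violated (erase x E.1) E') s.
    apply/allP => E' E's; apply/negP => vE'.
    have vE'0 : violated x E'.
      by apply/allP => u /(allP vE'); rewrite ffunE; case: ifP.
    have := violated_mem vE' (hs' _ E's vE'0).
    by rewrite ffunE Ev.
  elim: (s) => //= E' s' IHs /andP[/negbTE -> h]; exact: IHs.
case: (IH x hs') => [[h ->]|[E' E's [vE' ->]]]; first by left.
by right; exists E' => //; rewrite inE E's orbT.
Qed.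

Lemma legal_repair v x :
  (forall E, E \in evs -> violated x E -> v \in E.1) -> legal (repair x).
Proof.
move=> h; rewrite /repair; have [[hl ->] //|[E Ein [vE ->]]] := repair_foldl h.
apply/allP => E' E'in; apply/negP => vE'.
have vE'0 := violated_erase vE'.
have := violated_mem vE' (h _ E'in vE'0).
by rewrite ffunE (h _ Ein vE).
Qed.

Lemma violated_paint x v c E : legal x -> E \in evs ->
  violated (paint x v c) E -> v \in E.1.
Proof.
move=> lx Ein vE; apply/negPn/negP => nv.
have /allP /(_ _ Ein) /negP := lx; apply.
apply/allP => u uE; move/allP: vE => /(_ u uE); rewrite ffunE.
by case: (eqVneq u v) uE => [-> | //]; rewrite (negbTE nv).
Qed.

Lemma legal_attempt x c : legal x -> legal (attempt x c).
Proof.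
move=> lx; rewrite /attempt /place.
case: next => [v|]; last by rewrite repair_legal.
case: ifP => _; first by rewrite repair_legal.
by apply: (legal_repair (v := v)) => E; exact: violated_paint.
Qed.

Lemma legal_search cs x : legal x -> legal (search x cs).
Proof.
by elim: cs x => //= c cs IH x lx; apply: IH; exact: legal_attempt.
Qed.

Lemma legal_start : legal [ffun=> None].
Proof.
apply/allP => -[e c] /evs_uniq /= /andP[_ /eqP se].
apply/negP => /allP h; case: e se h => [|u e]; first by move: r_gt0 => /= /[swap] <-.
by move=> _ /(_ u (mem_head _ _)); rewrite ffunE.
Qed.

Lemma unfinished_done T x : legal x -> blank x = set0 -> unfinished T x = 0.
Proof.
move=> lx bx; apply: eq_card0 => cs; rewrite inE /=.
suff -> : search x cs = x by rewrite bx eqxx.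
elim: (val cs) => //= c s IH; rewrite -[RHS]IH; congr foldl.
rewrite /attempt /place; case En: next => [v|]; last exact: repair_legal.
by have := next_some En; rewrite bx inE.
Qed.

Lemma unfinishedS T x : unfinished T.+1 x = \sum_c unfinished T (attempt x c).
Proof. exact: (card_consE T (fun cs => blank (search x cs) != set0)). Qed.

Lemma card_blank U :
  #|[pred x | blank x == U]| * #|C| ^ #|U| <= #|C| ^ #|V|.
Proof.
have -> : #|[pred x | blank x == U]|
    = #|family (fun u : V => if u \in U then pred1 (@None C)
                             else [pred o | o != None])|.
  apply: eq_card => x; rewrite !inE; apply/eqP/familyP => [<- u|h].
    by rewrite !inE; case: ifP; rewrite inE // => /negbT.
  apply/setP => u; rewrite inE; have := h u; case: ifP; rewrite inE //.
  by move=> _ /negbTE.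
rewrite card_family foldrE big_image /=.
rewrite (bigID (mem U)) /= big1 ?mul1n; last first.
  by move=> u uU; rewrite /= uU card1.
rewrite (eq_bigr (fun=> #|C|)) => [|u /negbTE uU]; last first.
  rewrite uU; have := cardC (pred1 (@None C)).
  rewrite card1 card_option add1n => -[<-].
  by apply: eq_card => o; rewrite !inE.
rewrite prod_nat_const -expnD leq_eqVlt; apply/orP; left; apply/eqP.
congr (_ ^ _); rewrite addnC -(cardsC U); congr (_ + _).
by apply: eq_card => u; rewrite !inE.
Qed.

(** The outcome of an attempt is determined by a small label: the block is
    banned, or nothing is violated, or a given event through [v] was erased.
    Bounding the actual outcome by the sum over all labels is what makes the
    counting below insensitive to the history of the search. *)
Lemma attempt_bound T x v c : legal x -> next (blank x) = Some v ->
  unfinished T (attempt x c) <=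
    ban v c * unfinished T x
  + legal (paint x v c) * unfinished T (paint x v c)
  + \sum_(E <- evs | (v \in E.1) && (E.2 == c))
       violated (paint x v c) E * unfinished T (erase (paint x v c) E.1).
Proof.
move=> lx nv; rewrite /attempt /place nv.
case: ifP => bvc; first by rewrite repair_legal // mul1n -addnA leq_addr.
rewrite mul0n add0n.
have hv E : E \in evs -> violated (paint x v c) E -> v \in E.1.
  exact: violated_paint.
have [[hl hr]|[E Ein [vE hr]]] := repair_foldl hv.
  by rewrite /repair hr /legal hl mul1n leq_addr.
rewrite /repair hr; apply: leq_trans (leq_addl _ _).
rewrite (big_rem E) //= (hv _ Ein vE).
have := violated_mem vE (hv _ Ein vE); rewrite ffunE eqxx => -[<-].
by rewrite eqxx vE mul1n leq_addr.
Qed.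

(** The search is started from all legal colorings with blank set [U] at once.
    For a fixed label, an attempt is injective on these colorings, so their mass
    spreads evenly and never has to be tracked coloring by coloring. *)
Let S T U := \sum_(x | legal x && (blank x == U)) unfinished T x.

Lemma blank_paint x v c : blank (paint x v c) = blank x :\ v.
Proof. by apply/setP => u; rewrite !inE ffunE; case: (u == v). Qed.

(** Knowing which vertex was painted, one reads off the color used and recovers
    the previous coloring by blanking that vertex. *)
Lemma paint_inj U v : v \in U ->
  {in [pred p : partial * C | blank p.1 == U] &,
     injective (fun p => paint p.1 v p.2)}.
Proof.
move=> vU [x c] [x' c']; rewrite !inE /= => /eqP bx /eqP bx' /ffunP h.
have := h v; rewrite !ffunE eqxx => -[->]; congr (_, _); apply/ffunP => u.
have := h u; rewrite !ffunE; case: eqP => // -> _.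
move: (vU) (vU); rewrite -{1}bx -bx' !inE => /eqP -> /eqP ->; done.
Qed.

Lemma blank_erase x e : blank (erase x e) = blank x :|: [set u in e]%SET.
Proof.
by apply/setP => u; rewrite !inE ffunE; case: (u \in e); rewrite ?orbT ?orbF.
Qed.

(** One step of the recursion on [S]. In the last term the coloring is recovered
    from the erased event: all its vertices had the color [E.2], and one of them
    was the vertex just painted. The boolean factor says that the event consists
    of [v] and of vertices outside [U], so that erasing it blanks [r] vertices. *)
Lemma attempt_sum T U v : next U = Some v ->
  S T.+1 U <= #|ban v| * S T U + S T (U :\ v)
     + \sum_(E <- evs | v \in E.1)
         (violated (paint [ffun u => if u \in U then None else Some E.2] v E.2) E)
         * S T ((U :\ v) :|: [set u in E.1]%SET).
Proof.
move=> nv; have vU := next_some nv.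
rewrite /S; under eq_bigr do rewrite unfinishedS.
apply: leq_trans (_ : _ <= \sum_(x | legal x && (blank x == U)) \sum_c
   (ban v c * unfinished T x
  + legal (paint x v c) * unfinished T (paint x v c)
  + \sum_(E <- evs | (v \in E.1) && (E.2 == c))
       violated (paint x v c) E * unfinished T (erase (paint x v c) E.1))) _.
  apply: leq_sum => x /andP[lx /eqP bx]; apply: leq_sum => c _.
  by apply: attempt_bound; rewrite ?bx.
under eq_bigr do rewrite !big_split /=.
rewrite !big_split /= -!addnA; apply: leq_add; [|apply: leq_add].
- rewrite big_distrr /=; apply: leq_sum => x _; rewrite -big_distrl /=.
  rewrite leq_mul2r -sum1_card [in leqRHS]big_mkcond; apply/orP; right.
  by apply: leq_sum => c _; rewrite unfold_in; case: (ban v c).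
- rewrite pair_big /= [leqLHS](bigID (fun p => legal (paint p.1 v p.2))) /=.
  rewrite [X in _ + X]big1 ?addn0; last first.
    by move=> p /andP[_ /negbTE ->]; rewrite mul0n.
  rewrite (eq_bigr (fun p => unfinished T (paint p.1 v p.2))); last first.
    by move=> p /andP[_ ->]; rewrite mul1n.
  apply: (leq_sum_inj (h := fun p => paint p.1 v p.2)).
    move=> p p'; rewrite !unfold_in /= => /andP[/andP[/andP[_ h] _] _] /andP[/andP[/andP[_ h'] _] _].
    exact: (paint_inj vU).
  move=> p /andP[/andP[/andP[lp /eqP bp] _] ->] /=.
  by rewrite blank_paint bp.
- under eq_bigr => x hx.
    rewrite (exchange_big_dep (fun E => v \in E.1)) /=; last by move=> c E _ /andP[].
    under eq_bigr => E vE.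
      rewrite (big_pred1 E.2); last by move=> c /=; rewrite vE eq_sym.
      over.
    over.
  rewrite exchange_big /= big_seq_cond [leqRHS]big_seq_cond.
  apply: leq_sum => E /andP[Ein vE].
  rewrite (bigID (fun x => violated (paint x v E.2) E)) /=.
  rewrite [X in _ + X]big1 ?addn0; last first.
    by move=> x /andP[_ /negbTE ->]; rewrite mul0n.
  rewrite (eq_bigr (fun x => unfinished T (erase (paint x v E.2) E.1))); last first.
    by move=> x /andP[_ ->]; rewrite mul1n.
  case: (boolP (violated _ _)) => vio; last first.
    rewrite big_pred0 // => x; apply/negP => /andP[/andP[_ /eqP bx] /allP vx].
    move/negP: vio; apply; apply/allP => u uE.
    move: (vx u uE); rewrite !ffunE; case: (u == v) => // /eqP xu.
    by rewrite -bx inE xu.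
  rewrite mul1n; apply: (leq_sum_inj (h := fun x => erase (paint x v E.2) E.1)).
    move=> x x'; rewrite !unfold_in /=.
    move=> /andP[/andP[_ /eqP bx] vx] /andP[/andP[_ /eqP bx'] vx'] /ffunP h.
    have : (x, E.2) = (x', E.2).
      apply: (paint_inj vU); rewrite ?inE /= ?bx ?bx' ?eqxx //.
      apply/ffunP => u; have := h u; rewrite !(ffunE _ u).
      case: ifP => // uE _; move: (violated_mem vx uE) (violated_mem vx' uE).
      by rewrite !ffunE => -> ->.
    by case.
  move=> x /andP[/andP[lx /eqP bx] vx]; rewrite blank_erase blank_paint bx eqxx andbT.
  apply/allP => E' E'in; apply/negP => vE'.
  have h := violated_erase vE'.
  have := violated_mem vE' (violated_paint lx E'in h).
  by rewrite ffunE vE.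
Qed.

Hypothesis ban_few : forall v, 8 * #|ban v| <= #|C|.
Hypothesis evs_few : forall v, count (fun E => v \in E.1) evs <= #|C| * D.
Hypothesis D_small : 8 * (D * 2 ^ r.-1) <= #|C| ^ r.-1.
Hypothesis C_gt0 : 0 < #|C|.

(** The mass on unfinished searches decays by 3/4 at each attempt, if each blank
    vertex is given the weight 2. Of these 3/4, the banned blocks account for
    1/8, the successful attempts for 1/2 (a blank vertex is lost), and the erased
    events for 1/8: there are [#|C| * D] of them through a vertex, each creates
    [r.-1] blank vertices and each forces [r] colors, which is the content of the
    hypothesis [D_small]. *)
Lemma search_bound T U :
  S T U * 4 ^ T * #|C| ^ #|U| <= (3 * #|C|) ^ T * #|C| ^ #|V| * 2 ^ #|U|.
Proof.
elim: T U => [|T IH] U.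
  rewrite !expn0 mul1n muln1; case: (eqVneq U set0) => [->|U0].
    rewrite /S big1 // => x /andP[lx /eqP bx]; exact: unfinished_done.
  apply: leq_trans (leq_pmulr _ _); last by rewrite expn_gt0.
  apply: leq_trans (card_blank U); rewrite leq_mul2r; apply/orP; right.
  rewrite /S -sum1_card.
  rewrite [leqLHS]big_mkcond [leqRHS]big_mkcond; apply: leq_sum => x _.
  rewrite inE; case: (blank x == U); rewrite ?andbF // andbT.
  case: legal => //; rewrite /unfinished.
  by rewrite (leq_trans (max_card _)) // card_tuple expn0.
case nv: (next U) => [v|]; last first.
  rewrite (next_none nv) /S big1 // => x /andP[lx /eqP bx].
  exact: unfinished_done.
have vU := next_some nv.
have := attempt_sum T nv.
set t3 := \sum_(E <- evs | _) _ => hS.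
set l := #|C| in IH *; set A := (3 * l) ^ T * l ^ #|V|.
have IHA U' : S T U' * 4 ^ T * l ^ #|U'| <= A * 2 ^ #|U'| by exact: IH.
have cU : #|U| = #|U :\ v|.+1 by rewrite (cardsD1 v) vU.
set u := #|U :\ v| in cU.
(* erasing an event turns |U| blank vertices into |U| + r - 1 *)
have h3 : l ^ r.-1 * (t3 * 4 ^ T * l ^ #|U|) <= l * D * (A * 2 ^ #|U| * 2 ^ r.-1).
  apply: leq_trans (_ : _ <= \sum_(E <- evs | v \in E.1) A * 2 ^ #|U| * 2 ^ r.-1) _.
    rewrite /t3 !big_distrl big_distrr /= big_seq_cond [leqRHS]big_seq_cond.
    apply: leq_sum => E /andP[Ein vE].
    case: (boolP (violated _ E)) => vio; last by rewrite mul0n muln0.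
    have := evs_uniq Ein => /andP[uE /eqP sE].
    rewrite mul1n.
    have cE : #|(U :\ v) :|: [set w in E.1]%SET| = #|U| + r.-1.
      rewrite cardsU; have -> : (U :\ v) :&: [set w in E.1]%SET = set0.
        apply/setP => w; rewrite !inE; apply/negP => /andP[/andP[wv wU] wE].
        by have := violated_mem vio wE; rewrite !ffunE (negbTE wv) wU.
      rewrite cards0 subn0 cU -/u cardsE (card_uniqP uE) sE.
      by case: (r) r_gt0 => //= r' _; rewrite addnS addSn.
    have := IHA ((U :\ v) :|: [set w in E.1]%SET).
    rewrite cE !expnD; set s := S _ _; nia.
  rewrite big_const_seq iter_addn_0 mulnC leq_mul2r.
  by rewrite evs_few orbT.
have h1 := IHA U; have h2 := IHA (U :\ v); rewrite -/u in h2.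
have hb := ban_few v.
set s1 := S T U in h1 hS; set s2 := S T (U :\ v) in h2 hS.
have l0 : 0 < l ^ r.-1 by rewrite expn_gt0 C_gt0.
rewrite -(leq_pmul2l l0).
apply: leq_trans (_ : _ <= l ^ r.-1 * ((#|ban v| * s1 + s2 + t3) * 4 ^ T.+1 * l ^ #|U|)) _.
  by rewrite leq_mul2l !leq_mul2r hS !orbT.
rewrite [(3 * l) ^ T.+1]expnS -[(3 * l) * _ * _]mulnA -/A.
rewrite (expnS 4 T).
set X := A * 2 ^ #|U| in h3 h1 *.
have h1' : 8 * (#|ban v| * (s1 * 4 ^ T * l ^ #|U|)) <= l * X.
  by rewrite mulnA; apply: leq_mul.
have h2' : 2 * (s2 * 4 ^ T * l ^ #|U|) <= l * X.
  rewrite /X cU !expnS; move: h2; nia.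
have h3' : 8 * (l ^ r.-1 * (t3 * 4 ^ T * l ^ #|U|)) <= l ^ r.-1 * (l * X).
  apply: leq_trans (_ : _ <= 8 * (l * D * (X * 2 ^ r.-1))) _.
    by rewrite leq_mul2l h3.
  have -> : 8 * (l * D * (X * 2 ^ r.-1)) = 8 * (D * 2 ^ r.-1) * (l * X) by nia.
  by rewrite leq_mul2r D_small orbT.
have -> : l ^ r.-1 * ((#|ban v| * s1 + s2 + t3) * (4 * 4 ^ T) * l ^ #|U|)
  = l ^ r.-1 * (4 * (#|ban v| * (s1 * 4 ^ T * l ^ #|U|)))
    + l ^ r.-1 * (4 * (s2 * 4 ^ T * l ^ #|U|))
    + 4 * (l ^ r.-1 * (t3 * 4 ^ T * l ^ #|U|)) by nia.
have -> : l ^ r.-1 * (3 * l * A * 2 ^ #|U|) = l ^ r.-1 * (3 * (l * X)).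
  by rewrite /X; nia.
set p1 := _ * (s1 * _ * _) in h1' *; set p2 := s2 * _ * _ in h2' *.
set p3 := l ^ r.-1 * (t3 * _ * _) in h3' *; set Y := l * X in h1' h2' h3' *.
move: h1' h2' h3'; set z := l ^ r.-1; move=> *.
have : z * (8 * p1) <= z * Y by rewrite leq_mul2l; apply/orP; right.
have : z * (2 * p2) <= z * Y by rewrite leq_mul2l; apply/orP; right.
lia.
Qed.

Lemma search_fails T :
  unfinished T [ffun=> None] * 4 ^ T <= (3 * #|C|) ^ T * 2 ^ #|V|.
Proof.
have := search_bound T setT; rewrite cardsT.
have l0 : 0 < #|C| ^ #|V| by rewrite expn_gt0 C_gt0.
move=> h; rewrite -(leq_pmul2r l0) [leqRHS]mulnAC; apply: leq_trans h.
rewrite !leq_mul2r; apply/orP; right; apply/orP; right.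
rewrite /S (bigD1 [ffun=> None]) ?leq_addr //= legal_start /=.
by apply/eqP/setP => u; rewrite !inE ffunE.
Qed.
End Search.

(** * What is remembered of the stream *)

Section Reading.
Variables (V : finType) (r D l : nat).
Implicit Types (f : V -> nat) (e : seq V) (es : seq (seq V)).
Implicit Types (X : 'I_l -> V -> nat) (j : 'I_l).

(** Only the first [r] vertices of an edge matter: a coloring that is not
    constant on them is not constant on the edge. *)
Definition clash f e := constant [seq f u | u <- take r e].
Definition load f es v := count (fun e => clash f e && (v \in take r e)) es.
(** [X j v] is the color that the vertex [v] takes if it chooses the block [j];
    the crowded pairs are never used by the final coloring. *)
Definition crowded X es v j := D < load (X j) es v.
Definition kept X es e j :=
  clash (X j) e && all (fun u => ~~ crowded X es u j) (take r e).
Definition new_events X es e : seq (seq V * 'I_l) :=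
  [seq (take r e, j) | j <- enum 'I_l & kept X es e j].
Fixpoint events_after X seen es :=
  if es is e :: es' then
    new_events X (rcons seen e) e ++ events_after X (rcons seen e) es'
  else [::].
Definition events X es := events_after X [::] es.

Lemma events_rcons X es e :
  events X (rcons es e) = events X es ++ new_events X (rcons es e) e.
Proof.
rewrite /events -[in X in _ ++ X](cat0s es).
elim: es [::] => [|e' es IH] seen /=; first by rewrite cats0 cats0.
by rewrite IH catA cat_rcons.
Qed.

Lemma load_rcons f es e v :
  load f (rcons es e) v = load f es v + (clash f e && (v \in take r e)).
Proof. by rewrite /load -cats1 count_cat /= addn0. Qed.

Lemma events_sub X es E : E \in events X es -> exists2 e, e \in es & E.1 = take r e.
Proof.
elim/last_ind: es => // es e IH; rewrite events_rcons mem_cat => /orP[/IH [e' h ->]|].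
  by exists e' => //; rewrite mem_rcons inE h orbT.
by case/mapP=> j _ ->; exists e => //; rewrite mem_rcons mem_head.
Qed.

Lemma count_new_events X es e v j :
  count (fun E => (v \in E.1) && (E.2 == j)) (new_events X es e)
  = kept X es e j && (v \in take r e).
Proof.
rewrite count_map count_filter.
rewrite (eq_count (a2 := fun i => [&& v \in take r e, kept X es e j & i == j])).
  case: (v \in _) (kept X es e j) => -[] /=; rewrite ?count_pred0 //.
  by rewrite (count_uniq_mem j (enum_uniq _)) mem_enum.
by move=> i /=; case: eqVneq => [->|]; rewrite ?andbF ?andbT.
Qed.

(** An event is stored only when the loads of its vertices, counting the edge just
    read, are at most [D]; so each stored event at [(v, j)] raised the load of
    [(v, j)] to a distinct value in the interval from 1 to [D]. *)
Lemma events_degree_load X es v j :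
  count (fun E => (v \in E.1) && (E.2 == j)) (events X es)
    <= minn D (load (X j) es v).
Proof.
elim/last_ind: es => // es e IH; rewrite events_rcons count_cat count_new_events.
rewrite load_rcons; case K: (kept _ _ _ _ && _); last by move: IH; lia.
have /andP[/andP[cl /allP h] ve] := K.
by have := h v ve; rewrite /crowded load_rcons cl ve; move: IH; lia.
Qed.

Lemma events_degree X es v : count (fun E => v \in E.1) (events X es) <= l * D.
Proof.
have -> : count (fun E => v \in E.1) (events X es)
   = \sum_(j < l) count (fun E => (v \in E.1) && (E.2 == j)) (events X es).
  elim: (events X es) => [|E s IH] /=; first by rewrite big1.
  rewrite big_split /= -IH; congr (_ + _).
  rewrite (bigD1 E.2) //= eqxx andbT big1 ?addn0 // => j /negbTE.
  by rewrite eq_sym => ->; rewrite andbF.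
apply: leq_trans (_ : _ <= \sum_(j < l) D) _.
  by apply: leq_sum => j _; apply: leq_trans (events_degree_load _ _ _ _) (geq_minl _ _).
by rewrite sum_nat_const card_ord.
Qed.

Lemma load_le_rcons f es e v : load f es v <= load f (rcons es e) v.
Proof. by rewrite load_rcons leq_addr. Qed.

(** Loads only grow, so if no vertex is crowded at the end, none was when the edge
    was read. *)
Lemma events_complete X es e j : e \in es -> clash (X j) e ->
  all (fun u => ~~ crowded X es u j) (take r e) -> (take r e, j) \in events X es.
Proof.
elim/last_ind: es => // es e' IH; rewrite mem_rcons inE events_rcons mem_cat => ein.
move=> cl ok; case/predU1P: ein => [->|ein] in cl ok *; apply/orP; [right|left].
  by apply/mapP; exists j => //; rewrite mem_filter mem_enum /kept cl ok.
apply: IH => //; apply/allP => u ue; move/allP: ok => /(_ u ue).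
by apply: contra => /leq_trans; apply; exact: load_le_rcons.
Qed.

Lemma size_le_sum_count (s : seq (seq V * 'I_l)) : 0 < r ->
  (forall E, E \in s -> uniq E.1 && (size E.1 == r)) ->
  size s <= \sum_v count (fun E => v \in E.1) s.
Proof.
move=> r0; elim: s => [|E s IH] h //=.
rewrite big_split /= -add1n; apply: leq_add; last first.
  by apply: IH => E' E's; apply: h; rewrite inE E's orbT.
have /andP[uE /eqP sE] := h E (mem_head _ _).
by rewrite -big_mkcond /= sum1_card (card_uniqP uE) sE.
Qed.

Lemma size_events X es : 0 < r ->
  (forall e, e \in es -> uniq e && (r <= size e)) ->
  size (events X es) <= #|V| * (l * D).
Proof.
move=> r0 hes; apply: leq_trans (size_le_sum_count r0 _) _.
  move=> E /events_sub[e ein ->]; have /andP[ue se] := hes e ein.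
  by rewrite take_uniq //= size_takel //.
rewrite -sum_nat_const; apply: leq_sum => v _; exact: events_degree.
Qed.

End Reading.

(** * Random tables have few crowded entries *)

(** By induction on [s]: recoloring [w] arbitrarily is injective on the pairs of a
    coloring monochromatic on [w :: s] and a color. *)
Lemma monochrome_card (V C : finType) (u : V) (s : seq V) : uniq (u :: s) ->
  #|[pred f : {ffun V -> C} | all (fun w => f w == f u) s]| * #|C| ^ size s
    <= #|C| ^ #|V|.
Proof.
elim: s => [|w s IH] /=.
  by rewrite muln1 -card_ffun => _; exact: max_card.
rewrite inE negb_or => /andP[/andP[uw us] /andP[ws s_uniq]].
apply: leq_trans (IH (introT andP (conj us s_uniq))).
rewrite expnS mulnA leq_mul2r -cardX; apply/orP; right.
pose h (p : {ffun V -> C} * C) : {ffun V -> C} :=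
  [ffun v => if v == w then p.2 else p.1 v].
rewrite -!sum1_card; apply: (leq_sum_inj (h := h) (fun=> 1)).
  move=> [f c] [f' c']; rewrite !inE /= !andbT => /andP[/eqP fw _] /andP[/eqP fw' _].
  move=> /ffunP E; have := E w; rewrite !ffunE eqxx /= => ->; congr (_, _).
  apply/ffunP => v; have := E v; rewrite !ffunE; case: (eqVneq v w) => // -> _.
  by have := E u; rewrite !ffunE (negbTE uw) fw fw'.
move=> [f c]; rewrite !inE /= andbT => /andP[_ /allP h1].
apply/allP => v vs; rewrite !ffunE (negbTE uw).
by case: (eqVneq v w) vs => [->|_ /h1 //]; rewrite (negbTE ws).
Qed.

Section Columns.
Variables (V : finType) (r D B Delta : nat) (es : seq (seq V)).
Hypothesis r_gt0 : 0 < r.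
Hypothesis es_ok : forall e, e \in es -> uniq e && (r <= size e).
Hypothesis es_degree : forall v, count (fun e => v \in e) es <= Delta.

Definition column (f : {ffun V -> 'I_B}) (v : V) : nat := f v.

Lemma clash_card e : uniq e && (r <= size e) ->
  #|[pred f | clash r (column f) e]| * B ^ r.-1 <= B ^ #|V|.
Proof.
move=> /andP[ue se]; rewrite /clash.
have : uniq (take r e) by rewrite take_uniq.
have : size (take r e) = r by rewrite size_takel.
case: (take r e) => [|u s] /=; first by move: r_gt0 => /[swap] <-.
move=> <- us /=; have := monochrome_card 'I_B us; rewrite card_ord.
apply: leq_trans; rewrite leq_mul2r; apply/orP; right.
by rewrite leq_eqVlt; apply/orP; left; apply/eqP/eq_card => f; rewrite !inE all_map.
Qed.

(** Markov's inequality for the load of [v] under a uniformly random column. *)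
Lemma crowded_card v :
  #|[pred f | D < load r (column f) es v]| * D.+1 * B ^ r.-1
    <= Delta * B ^ #|V|.
Proof.
apply: leq_trans (_ : (\sum_f load r (column f) es v) * B ^ r.-1 <= _).
  rewrite leq_mul2r; apply/orP; right; rewrite -sum_nat_const.
  rewrite [leqRHS](bigID (fun f => D < load r (column f) es v)) /=.
  by apply: leq_trans (leq_addr _ _); apply: leq_sum => f; rewrite inE.
have -> : \sum_f load r (column f) es v
  = \sum_(e <- es | v \in take r e) #|[pred f | clash r (column f) e]|.
  under eq_bigr => f _ do rewrite /load -sum1_count big_mkcond /=.
  rewrite exchange_big /= [RHS]big_mkcond; apply: eq_bigr => e _.
  case: (v \in _); last by rewrite big1 // => f; rewrite andbF.
  rewrite -sum1_card [RHS]big_mkcond; apply: eq_bigr => f _.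
  by rewrite andbT inE.
rewrite big_distrl /=.
apply: leq_trans (_ : _ <= \sum_(e <- es | v \in take r e) B ^ #|V|) _.
  rewrite big_seq_cond [leqRHS]big_seq_cond; apply: leq_sum => e /andP[ein _].
  exact: clash_card (es_ok ein).
rewrite big_const_seq iter_addn_0 mulnC leq_mul2r; apply/orP; right.
apply: leq_trans (es_degree v); apply: sub_count => e; exact: mem_take.
Qed.

Section Table.
Variables (l : nat).
Definition table (X : {ffun 'I_l -> {ffun V -> 'I_B}}) (j : 'I_l) : V -> nat :=
  column (X j).
Definition crowd (X : {ffun 'I_l -> {ffun V -> 'I_B}}) v :=
  #|[pred j | crowded r D (table X) es v j]|.

(** A Chernoff-type bound: the columns are independent, so the expectation of
    [2 ^ (16 * crowd X v)] is a product of [l] factors, each at most 2. *)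
Lemma crowd_card v :
  2 ^ 16 * #|[pred f | D < load r (column f) es v]| <= B ^ #|V| ->
  #|[pred X | l < 8 * crowd X v]| * 2 ^ l <= (B ^ #|V|) ^ l.
Proof.
set bad := [pred f | _] => hbad.
pose g f := if f \in bad then 2 ^ 16 else 1.
have : \sum_(X : {ffun 'I_l -> {ffun V -> 'I_B}}) \prod_(j < l) g (X j)
   <= (2 * B ^ #|V|) ^ l.
  rewrite -(bigA_distr_bigA (fun (j : 'I_l) f => g f)) /= prod_nat_const card_ord.
  case: (posnP l) => [-> //|l_gt0]; rewrite leq_exp2r //.
  rewrite (bigID (mem bad)) /=.
  rewrite (eq_bigr (fun=> 2 ^ 16)) => [|f fb]; last by rewrite /g fb.
  rewrite [X in _ + X](eq_bigr (fun=> 1)) => [|f /negbTE fb]; last by rewrite /g fb.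
  rewrite sum_nat_const mulnC mul2n -addnn; apply: leq_add => //.
  by rewrite sum1_card -[in leqRHS](card_ord B) -card_ffun max_card.
rewrite expnMn => h.
have h2 : #|[pred X | l < 8 * crowd X v]| * (2 ^ l * 2 ^ l) <= 2 ^ l * (B ^ #|V|) ^ l.
  apply: leq_trans h; rewrite -sum_nat_const.
  rewrite [leqRHS](bigID [pred X | l < 8 * crowd X v]) /=.
  apply: leq_trans (leq_addr _ _); apply: leq_sum => X; rewrite inE => hX.
  rewrite (bigID (fun j => X j \in bad)) /= [X in _ <= _ * X]big1 ?muln1; last first.
    by move=> j /negbTE; rewrite /g => ->.
  rewrite (eq_bigr (fun=> 2 ^ 16)) => [|j jb]; last by rewrite /g jb.
  rewrite prod_nat_const -expnD -expnM leq_exp2l //.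
  move: hX; rewrite /crowd.
  have -> : #|[pred j | crowded r D (table X) es v j]| = #|[pred j | X j \in bad]|.
    by apply: eq_card => j; rewrite !inE.
  lia.
have l0 : 0 < 2 ^ l by rewrite expn_gt0.
by rewrite -(leq_pmul2r l0) -mulnA [leqRHS]mulnC.
Qed.

Lemma no_crowd X v j : Delta <= D -> ~~ crowded r D (table X) es v j.
Proof.
move=> hD; rewrite /crowded -leqNgt (leq_trans _ hD) //.
apply: leq_trans (es_degree v); apply: sub_count => e /andP[_]; exact: mem_take.
Qed.
End Table.
End Columns.

(** * Sizes, and the probability of failure *)

Section Palette.
Variables (n r Delta : nat).
(** The palette has [2 ^ mexp] colors, the least power of two [q] for which
    [q ^ r.-1] reaches [2 ^ (r + 18) * Delta]. It is split into [nlist] blocks of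
    [nbase] colors, both powers of two. There are about [log n] blocks, unless the
    whole palette is smaller than that; then each block is a single color. *)
Definition mexp := up_log (2 ^ r.-1) (2 ^ (r + 18) * Delta).
Definition texp := up_log 2 (up_log 2 (4 * n * n)).
Definition aexp := minn mexp texp.
Definition bexp := mexp - aexp.
Definition nlist := 2 ^ aexp.
Definition nbase := 2 ^ bexp.
(** The expected load is at most [nlist ^ r.-1 / 2 ^ (r + 18)], so that a load above
    [cap] has probability at most [2 ^ (- 16)]; and [cap] is small enough for the
    backtracking search, see [cap_small]. *)
Definition cap := nlist ^ r.-1 %/ 2 ^ (r + 2).

Hypothesis r_ge2 : 1 < r.

Lemma base_gt1 : 1 < 2 ^ r.-1.
Proof. by rewrite -{1}(expn0 2) ltn_exp2l //; case: r r_ge2 => [|[]]. Qed.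

Lemma palette_split : 2 ^ mexp = nlist * nbase.
Proof. by rewrite -expnD subnKC // geq_minl. Qed.

Lemma palette_large : 2 ^ (r + 18) * Delta <= (nlist * nbase) ^ r.-1.
Proof.
by rewrite -palette_split -expnM [_ * r.-1]mulnC expnM /mexp up_logP ?base_gt1. Qed.

Lemma palette_small : 0 < Delta -> (2 ^ mexp) ^ r.-1 < 2 ^ r.-1 * (2 ^ (r + 18) * Delta).
Proof.
move=> D0; rewrite -expnM mulnC expnM.
have h : 1 < 2 ^ (r + 18) * Delta.
  by apply: leq_trans (leq_pmulr _ D0); rewrite -{1}(expn0 2) ltn_exp2l // addnS.
have := up_log_gtn base_gt1 h; rewrite -/mexp.
have : 0 < mexp by rewrite /mexp up_log_gt0 base_gt1.
case: mexp => // m _ /= hm.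
by rewrite expnS ltn_pmul2l // expn_gt0.
Qed.

Lemma cap_small : 8 * (cap * 2 ^ r.-1) <= nlist ^ r.-1.
Proof.
apply: leq_trans (leq_trunc_div _ (2 ^ (r + 2))); rewrite -/cap.
rewrite mulnCA leq_mul2l; apply/orP; right.
by rewrite -[8]/(2 ^ 3) -expnD leq_exp2l //; case: (r) r_ge2 => //=; lia.
Qed.

Lemma cap_large : nlist ^ r.-1 < cap.+1 * 2 ^ (r + 2).
Proof. by rewrite -ltn_divLR // expn_gt0. Qed.

(** Either the table is not random at all, or it has enough columns for a union
    bound over the vertices. *)
Lemma nlist_tail : bexp = 0 \/ 4 * n * n <= 2 ^ nlist.
Proof.
rewrite /bexp /nlist /aexp.
case: (leqP mexp texp) => h; first by left; rewrite subnn.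
right; apply: leq_trans (up_logP _ (isT : 1 < 2)) _.
by rewrite leq_exp2l // up_logP.
Qed.

Definition ntry := 10 * n.

Definition least (U : {set 'I_n}) : option 'I_n :=
  [pick v in U | [forall w in U, v <= w]].

Lemma least_some U v : least U = Some v -> v \in U.
Proof. by rewrite /least; case: pickP => // u /andP[uU _] [<-]. Qed.

Lemma leastP (U : {set 'I_n}) (v : 'I_n) : v \in U -> (forall w, w \in U -> v <= w) ->
  least U = Some v.
Proof.
move=> vU vmin; rewrite /least; case: pickP => [u /andP[uU /forall_inP h]|].
  by congr Some; apply/val_inj/eqP; rewrite eqn_leq /= h ?vmin.
by move=> /(_ v); rewrite vU /= => /negP[]; apply/forall_inP.
Qed.

Lemma least_none U : least U = None -> U = set0.
Proof.
case: (set_0Vmem U) => // -[v vU].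
by case: (arg_minnP (fun w : 'I_n => val w) vU) => u uU /(leastP uU) ->.
Qed.

Variable es : seq (seq 'I_n).
Hypothesis n_gt1 : 1 < n.
Hypothesis es_ok : forall e, e \in es -> uniq e && (r <= size e).
Hypothesis es_degree : forall v, count (fun e => v \in e) es <= Delta.

Definition random_table := {ffun 'I_nlist -> {ffun 'I_n -> 'I_nbase}}.
Implicit Type X : random_table.

Definition final (X : 'I_nlist -> 'I_n -> nat) (cs : seq 'I_nlist) :=
  search (fun v j => crowded r cap X es v j) (events r cap X es) least
    [ffun=> None] cs.

Lemma nlist_gt0 : 0 < nlist. Proof. by rewrite expn_gt0. Qed.
Lemma nbase_gt0 : 0 < nbase. Proof. by rewrite expn_gt0. Qed.
Let r_gt0 : 0 < r := ltnW r_ge2.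

Lemma events_ok (X : 'I_nlist -> 'I_n -> nat) E :
  E \in events r cap X es -> uniq E.1 && (size E.1 == r).
Proof.
move=> /events_sub[e ein ->]; have /andP[ue se] := es_ok ein.
by rewrite take_uniq //= size_takel.
Qed.

(** By [palette_large] the expected load is at most [2 ^ (- 16)] times the
    threshold [cap.+1], see [cap_large]. *)
Lemma crowded_rare v :
  2 ^ 16 * #|[pred f | cap < load r (@column 'I_n nbase f) es v]| <= nbase ^ n.
Proof.
have := crowded_card cap nbase r_gt0 es_ok es_degree v.
set bad := #|_|; rewrite card_ord => h.
have h2 := palette_large; have h3 := cap_large.
have p0 : 0 < cap.+1 * 2 ^ (r + 2) * nbase ^ r.-1.
  by rewrite !muln_gt0 !expn_gt0.
rewrite -(leq_pmul2r p0).
rewrite expnMn in h2.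
have e1 : 2 ^ (r + 18) = 2 ^ 16 * 2 ^ (r + 2) by rewrite -expnD; congr (_ ^ _); lia.
rewrite e1 in h2; move: h h2 h3 p0.
move: (2 ^ (r + 2)) (2 ^ 16) (nbase ^ r.-1) (nlist ^ r.-1) (nbase ^ n) => C' K Br lr Bn.
move=> h h2 h3 p0.
have -> : K * bad * (cap.+1 * C' * Br) = bad * cap.+1 * Br * (K * C') by nia.
apply: leq_trans (_ : Delta * Bn * (K * C') <= _); first by rewrite leq_mul2r h orbT.
have -> : Delta * Bn * (K * C') = (K * C' * Delta) * Bn by nia.
rewrite mulnC leq_mul2l; apply/orP; right; apply: leq_trans h2 _.
by rewrite leq_mul2r ltnW ?orbT.
Qed.

(** When blocks are single colors, the load of [v] is at most its degree. *)
Lemma cap_no_crowd X v : bexp = 0 -> crowd r cap es X v = 0.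
Proof.
move=> b0; apply: eq_card0 => j; rewrite !inE; apply/negbTE.
apply: (@no_crowd _ r cap nbase Delta es es_degree nlist X v j).
rewrite /cap leq_divRL ?expn_gt0 // mulnC.
have := palette_large; rewrite /nbase b0 expn0 muln1; apply: leq_trans.
by rewrite leq_mul2r leq_exp2l // leq_add2l orbT.
Qed.

Lemma crowd_rare :
  #|[pred X : random_table | [exists v, nlist < 8 * crowd r cap es X v]]| * (4 * n)
    <= (nbase ^ n) ^ nlist.
Proof.
have [b0|tail] := nlist_tail.
  rewrite eq_card0 // => X; rewrite !inE; apply/negbTE.
  by rewrite negb_exists; apply/forallP => v; rewrite cap_no_crowd.
have n0 : 0 < n by lia.
rewrite -(leq_pmul2r n0) -mulnA; set bad := #|_|.
apply: leq_trans (_ : bad * 2 ^ nlist <= _); first by rewrite leq_mul2l tail orbT.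
apply: leq_trans (_ : (\sum_v #|[pred X : random_table | nlist < 8 * crowd r cap es X v]|) * 2 ^ nlist <= _).
  rewrite leq_mul2r; apply/orP; right.
  rewrite /bad -sum1_card (eq_bigr _ (fun v _ => esym (sum1_card _))).
  rewrite (exchange_big_dep xpredT) //= [leqRHS](bigID [pred X : random_table | [exists v, nlist < 8 * crowd r cap es X v]]) /=.
  apply: leq_trans (leq_addr _ _); apply: leq_sum => X.
  by rewrite inE => /existsP[v hv]; rewrite (bigD1 v).
rewrite big_distrl /= mulnC -[X in X * _](card_ord n) -sum_nat_const; apply: leq_sum => v _.
have := @crowd_card 'I_n r cap nbase es r_gt0 nlist v; rewrite card_ord.
by apply; exact: crowded_rare.
Qed.

(** Either some vertex has more than an eighth of its blocks crowded, or the search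
    of [search_fails] applies with banned pairs the crowded ones; after [10 * n]
    attempts the bound [(3/4) ^ (10 * n) * 2 ^ n] is at most [8 ^ (- n)]. *)
Lemma failure_rare :
  #|[pred p : random_table * ntry.-tuple 'I_nlist |
      blank (final (table p.1) p.2) != set0]| * n
    <= (nbase ^ n) ^ nlist * nlist ^ ntry.
Proof.
set crowdy := [pred X : random_table | [exists v, nlist < 8 * crowd r cap es X v]].
have h1 : #|[pred p : random_table * ntry.-tuple 'I_nlist |
      blank (final (table p.1) p.2) != set0]|
   <= \sum_X (if crowdy X then nlist ^ ntry else
       unfinished (fun v j => crowded r cap (table X) es v j)
         (events r cap (table X) es) least ntry [ffun=> None]).
  rewrite -sum1_card.
  rewrite -(pair_big_dep xpredT (fun X (cs : ntry.-tuple 'I_nlist) => blank (final (table X) cs) != set0) (fun _ _ => 1)) /=.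
  apply: leq_sum => X _; rewrite sum1_card; case: ifP => _; last first.
    by rewrite leq_eqVlt; apply/orP; left; apply/eqP/eq_card => cs.
  by rewrite (leq_trans (max_card _)) // card_tuple card_ord.
have h2 X : ~~ crowdy X ->
  unfinished (fun v j => crowded r cap (table X) es v j)
         (events r cap (table X) es) least ntry [ffun=> None] * (4 * n) <= nlist ^ ntry.
  rewrite /= negb_exists => /forallP few.
  have := @search_fails _ _ r cap (fun v j => crowded r cap (table X) es v j)
    (events r cap (table X) es) least least_some least_none r_gt0 (@events_ok _).
  rewrite !card_ord => /(_ _ _ cap_small nlist_gt0 ntry) h.
  have {h} := h _ (events_degree _ _ _ _).
  have fw v : 8 * #|(fun j => crowded r cap (table X) es v j)| <= nlist.
    by move: (few v); rewrite -leqNgt.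
  move=> /(_ fw); set u := unfinished _ _ _ _ _; rewrite /ntry expnMn.
  (* (3/4)^5 <= 1/4, hence (3/4)^(10 n) <= 16^(-n) *)
  have e4 : (3 ^ (10 * n) * 16 ^ n <= 4 ^ (10 * n)).
    have -> : 10 * n = 5 * (2 * n) by lia.
    have -> : 16 ^ n = 4 ^ (2 * n) by rewrite expnM.
    by rewrite !(expnM _ 5) -expnMn leq_exp2r //; lia.
  have e8 : 2 ^ n * (4 * n) <= 16 ^ n.
    elim: (n) n_gt1 => // m IH; rewrite ltnS leq_eqVlt => /predU1P[<- //|m1].
    have : 2 ^ m <= 2 ^ m * (4 * m) by rewrite leq_pmulr ?muln_gt0 ?(ltnW m1).
    have := IH m1; rewrite !expnS -mulnA mulnS mulnDr.
    by move: (2 ^ m) (16 ^ m) (_ * (4 * m)) => p s w; lia.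
  have p3 : 0 < 3 ^ (10 * n) by rewrite expn_gt0.
  have p2 : 0 < 2 ^ n by rewrite expn_gt0.
  move: e4 e8 p3 p2; move: (3 ^ _) (4 ^ _) (16 ^ _) (2 ^ n) (nlist ^ _) => t3 t4 t16 t2 L.
  move=> e4 e8 p3 p2 hu.
  rewrite -(leq_pmul2r p3) -(leq_pmul2r p2).
  apply: leq_trans (_ : u * t4 <= _); last by apply: leq_trans hu _; nia.
  rewrite -!mulnA leq_mul2l; apply/orP; right; apply: leq_trans e4; nia.
have h3 := crowd_rare; rewrite -/crowdy in h3.
have n4 : 0 < 4 by [].
rewrite -(leq_pmul2l n4) mulnCA.
apply: leq_trans (_ : (\sum_X (if crowdy X then nlist ^ ntry else
       unfinished (fun v j => crowded r cap (table X) es v j)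
         (events r cap (table X) es) least ntry [ffun=> None])) * (4 * n) <= _).
  by rewrite leq_mul2r h1 orbT.
rewrite big_distrl (bigID crowdy) /=.
rewrite (eq_bigr (fun=> nlist ^ ntry * (4 * n))) => [|X ->//].
rewrite sum_nat_const.
apply: leq_trans (_ : _ <= (nbase ^ n) ^ nlist * nlist ^ ntry + (nbase ^ n) ^ nlist * nlist ^ ntry) _; last by lia.
apply: leq_add; first by rewrite mulnA mulnAC leq_mul2r h3 orbT.
apply: leq_trans (_ : _ <= \sum_(X | ~~ crowdy X) nlist ^ ntry) _.
  by apply: leq_sum => X cX; rewrite (negbTE cX); exact: h2.
rewrite sum_nat_const leq_mul2r; apply/orP; right.
by rewrite (leq_trans (max_card _)) // !card_ffun !card_ord.
Qed.

End Palette.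

(** * The coloring produced by a successful search *)

Section SearchNotBanned.
Variables (V C : finType) (ban : V -> C -> bool).
Variables (evs : seq (seq V * C)) (next : {set V} -> option V).

Definition allowed (x : {ffun V -> option C}) :=
  forall v c, x v = Some c -> ~~ ban v c.

Lemma allowed_search cs x : allowed x -> allowed (search ban evs next x cs).
Proof.
elim: cs x => //= c cs IH x ax; apply: IH; rewrite /attempt.
have : allowed (place ban next x c).
  rewrite /place; case: next => [v|//]; case: ifP => // bvc u d.
  by rewrite ffunE; case: eqVneq => [-> [<-]|_ /ax //]; rewrite bvc.
move: (place _ _ _ _); rewrite /repair; elim: evs => //= E s IHs y ay.
apply: IHs; case: ifP => // _ u d; rewrite ffunE; case: ifP => // _; exact: ay.
Qed.
End SearchNotBanned.

Section Output.
Variables (n r Delta : nat).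
Hypothesis r_ge2 : 1 < r.
Variable es : seq (seq 'I_n).
Hypothesis es_ok : forall e, e \in es -> uniq e && (r <= size e).
Let l := nlist n r Delta.
Let B := nbase n r Delta.
Variables (X : 'I_l -> 'I_n -> nat) (cs : seq 'I_l).
Hypothesis X_lt : forall j v, X j v < B.

Definition color (x : {ffun 'I_n -> option 'I_l}) (v : 'I_n) : nat :=
  let j := odflt (Ordinal (nlist_gt0 n r Delta)) (x v) in j * B + X j v.

Lemma color_lt x v : color x v < 2 ^ mexp r Delta.
Proof.
rewrite (palette_split n r Delta) /color -/l -/B.
set j := odflt _ _; apply: leq_trans (_ : j * B + B <= _).
  by rewrite ltn_add2l.
by rewrite addnC -mulSn leq_mul2r ltn_ord orbT.
Qed.

(** A monochromatic edge has all its vertices in the same block [j], where they clash.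
    None of them is crowded there since the search avoids crowded pairs, so the
    event was stored; but then it is violated, against legality. *)
Lemma color_proper (x := @final n r Delta es X cs) : blank x = set0 ->
  forall e, e \in es -> ~ exists c, forall v, v \in e -> color x v = c.
Proof.
move=> full e ein [c mono].
have r0 : 0 < r by exact: ltnW.
have al : allowed (fun v j => crowded r (cap n r Delta) X es v j) x.
  by apply: allowed_search => v j; rewrite ffunE.
have lx : legal (events r (cap n r Delta) X es) x.
  apply: legal_search; apply: (@legal_start _ _ r) => //.
  by move=> E; exact: (events_ok es_ok).
have tot v : exists j, x v = Some j.
  case xv: (x v) => [j|]; first by exists j.
  by move/setP/(_ v): full; rewrite !inE xv.
have /andP[ue se] := es_ok ein.
case te: (take r e) => [|u s].
  have : size (take r e) = r by rewrite size_takel.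
  by rewrite te; move: r0 => /[swap] <-.
have sub v : v \in take r e -> v \in e by exact: mem_take.
have ue' : u \in e by apply: sub; rewrite te mem_head.
have [j xu] := tot u.
have key v : v \in e -> x v = Some j /\ X j v = X j u.
  move=> ve; have := mono v ve; rewrite -(mono u ue') /color xu /=.
  have [i ->] := tot v => /= E.
  have ij : val i = val j.
    have := congr1 (divn^~ B) E; have B0 : 0 < B by exact: nbase_gt0.
    by rewrite !divnMDl // !divn_small ?X_lt // !addn0.
  have {}ij : i = j by exact: val_inj.
  by subst i; split => //; move/addnI: E.
move/allP: lx => /(_ (take r e, j)) h; apply: (negP (h _)).
  apply: events_complete => //.
    rewrite /clash te /= all_map; apply/allP => v vs /=.
    by have [|_ ->] := key v; first by apply: sub; rewrite te inE vs orbT.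
  by apply/allP => v /mem_take /key[xv _]; exact: al.
by apply/allP => v /mem_take /key[-> _].
Qed.
End Output.

(** * Random numbers from coin flips *)

Section Digits.
Implicit Type coin : nat -> bool.

Fixpoint digit coin off w :=
  if w is w'.+1 then 2 * digit coin off w' + coin (off + w') else 0.

Lemma digit_lt coin off w : digit coin off w < 2 ^ w.
Proof. by elim: w => //= w; rewrite expnS; case: (coin _); lia. Qed.

Lemma digit_inj coin coin' off w : digit coin off w = digit coin' off w ->
  forall i, i < w -> coin (off + i) = coin' (off + i).
Proof.
elim: w => //= w IH E i; rewrite ltnS leq_eqVlt => /predU1P[->|iw]; last first.
  apply: IH => //; case: (coin _) (coin' _) E => -[]; lia.
by case: (coin _) (coin' _) E => -[] //; lia.
Qed.

Lemma eq_digit coin coin' off w :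
  (forall i, i < w -> coin (off + i) = coin' (off + i)) ->
  digit coin off w = digit coin' off w.
Proof.
elim: w => //= w IH h; rewrite h ?ltnSn // IH // => i iw.
by apply: h; exact: ltnW.
Qed.

Variables (n r Delta : nat).
Let l := nlist n r Delta.
Let a := aexp n r Delta.
Let b := bexp n r Delta.

Definition coin_table coin (j : 'I_l) (v : 'I_n) : nat :=
  digit coin ((v * l + j) * b) b.
Definition choice_start := n * l * b.
Definition coin_choice coin t : 'I_l :=
  Ordinal (digit_lt coin (choice_start + t * a) a).
Definition coin_choices coin := [seq coin_choice coin t | t <- iota 0 (ntry n)].
Definition ncoins := choice_start + ntry n * a.

Lemma table_coin coin v j i : v < n -> j < l -> i < b ->
  (v * l + j) * b + i < choice_start.
Proof. 
move=> vn jl ib; rewrite /choice_start.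
have h : v * l + j < n * l.
  by apply: leq_trans (_ : v.+1 * l <= _); [rewrite mulSn; lia|rewrite leq_mul2r vn orbT].
apply: leq_trans (_ : (v * l + j).+1 * b <= _); [rewrite mulSn; lia|].
by rewrite leq_mul2r h orbT.
Qed.

Variable es : seq (seq 'I_n).
Definition lucky coin :=
  blank (@final n r Delta es (coin_table coin) (coin_choices coin)) == set0.

Lemma eq_coins coin coin' : (forall i, i < ncoins -> coin i = coin' i) ->
  coin_table coin = coin_table coin' /\ coin_choices coin = coin_choices coin'.
Proof.
move=> h; split.
  apply/boolp.funext => j; apply/boolp.funext => v; apply: eq_digit => i ib.
  apply: h; rewrite /ncoins ltn_addr // -/b.
  exact: table_coin.
apply/eq_in_map => t; rewrite mem_iota /= add0n => tn; apply: val_inj.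
apply: eq_digit => i ia; apply: h; rewrite /ncoins -addnA ltn_add2l.
apply: leq_trans (_ : t.+1 * a <= _); first by rewrite mulSn; lia.
by rewrite leq_mul2r tn orbT.
Qed.

Hypothesis r_ge2 : 1 < r.
Hypothesis n_gt1 : 1 < n.
Hypothesis es_ok : forall e, e \in es -> uniq e && (r <= size e).
Hypothesis es_degree : forall v, count (fun e => v \in e) es <= Delta.

(** The coins are in bijection with the pairs of a table and a sequence of choices,
    because all the ranges are powers of two: the map from coins to pairs is
    injective and both sides have the same cardinality. *)
Lemma unlucky_rare :
  #|[pred t : ncoins.-tuple bool | ~~ lucky (nth false t)]| * n <= 2 ^ ncoins.
Proof.
pose tab coin : random_table n r Delta :=
  [ffun j : 'I_l => [ffun v : 'I_n =>
     Ordinal (digit_lt coin ((v * l + j) * b) b) : 'I_(nbase n r Delta)]].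
pose h (t : ncoins.-tuple bool) : random_table n r Delta * (ntry n).-tuple 'I_l :=
  (tab (nth false t), [tuple coin_choice (nth false t) i | i < ntry n]).
have -> : 2 ^ ncoins = (nbase n r Delta ^ n) ^ nlist n r Delta * nlist n r Delta ^ ntry n.
  by rewrite /ncoins /choice_start expnD -!expnM -/l -/b -/a; congr (2 ^ _ * 2 ^ _); nia.
apply: leq_trans (failure_rare r_ge2 n_gt1 es_ok es_degree).
rewrite leq_mul2r; apply/orP; right; rewrite -!sum1_card.
have tabE coin : table (tab coin) = coin_table coin.
  by apply/boolp.funext => j; apply/boolp.funext => v; rewrite /table /column !ffunE.
have chE t : (h t).2 = coin_choices (nth false t) :> seq 'I_l.
  by rewrite /coin_choices -val_enum_ord -map_comp.
apply: (leq_sum_inj (h := h) (fun=> 1)); last first.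
  move=> t; rewrite !inE /lucky -tabE -chE; exact.
move=> t t' _ _ [/ffunP E1 E2]; apply: eq_from_tnth => i.
rewrite !(tnth_nth false); case: (ltnP i choice_start) => hi; last first.
  have hn : i < choice_start + ntry n * a := ltn_ord i.
  have hi' : i - choice_start < ntry n * a by rewrite ltn_subLR.
  have a0 : 0 < a by rewrite lt0n; apply: contraTneq hi' => ->; rewrite muln0.
  have ti : (i - choice_start) %/ a < ntry n by rewrite ltn_divLR.
  move/eq_in_map: E2 => /(_ (Ordinal ti)).
  rewrite mem_enum => /(_ isT) /(congr1 val) /= /digit_inj /(_ ((i - choice_start) %% a)).
  rewrite ltn_mod a0 -addnA -divn_eq subnKC // => -> //.
have b0 : 0 < b.
  by rewrite lt0n; apply: contraTneq hi => b0; rewrite /choice_start b0 muln0.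
have l0 : 0 < l by exact: nlist_gt0.
have vn : i %/ b %/ l < n by rewrite !ltn_divLR.
have jl : i %/ b %% l < l by rewrite ltn_mod.
have /ffunP /(_ (Ordinal vn)) := E1 (Ordinal jl).
rewrite !ffunE => /(congr1 val) /= /digit_inj /(_ (i %% b)).
by rewrite ltn_mod b0 -divn_eq -divn_eq => -> //.
Qed.

End Digits.

(** * A program logic for the machine *)

Section Logic.
Variables (A : algorithm) (coin : nat -> bool) (N Bd : nat).

Definition store := nat -> nat.
Implicit Types (M : store) (Q : store -> nat -> seq nat -> Prop).

(** Expressions see the memory as a total function, which makes successive writes
    easy to evaluate; the list in the machine only matters for its size. *)
Fixpoint ev M (ed : seq nat) (e : expr) : nat :=
  match e with
  | Const c => c
  | Cell a => M (ev M ed a)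
  | EdgeSize => size ed
  | EdgeVertex i => nth 0 ed (ev M ed i)
  | BinOp o e1 e2 => binop_sem o (ev M ed e1) (ev M ed e2)
  end.

Lemma eval_ev m M ed e : nth 0 m =1 M -> eval m ed e = ev M ed e.
Proof.
by move=> mM; elim: e => //= [a ->|i ->|o e1 -> e2 ->] //; rewrite mM.
Qed.

Definition upd M a x : store := fun b => if b == a then x else M b.
Definition safe m := (size m <= N) && all (fun x => x <= Bd) m.

Lemma safe_set m a x : a < N -> x <= Bd -> safe m -> safe (set_nth 0 m a x).
Proof.
move=> aN xB /andP[sm /allP bm]; apply/andP; split.
  by rewrite size_set_nth geq_max aN sm.
apply/(all_nthP 0) => i; rewrite nth_set_nth /=; case: eqP => // _ _.
case: (ltnP i (size m)) => im; last by rewrite nth_default.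
exact/bm/mem_nth.
Qed.

Lemma nth_set m M a x : nth 0 m =1 M -> nth 0 (set_nth 0 m a x) =1 upd M a x.
Proof. by move=> mM b; rewrite nth_set_nth /= /upd mM. Qed.

Let stp := step A coin.

Definition steady p n c :=
  forall i, i <= n -> safe (memory (iter i stp c)) && (post (iter i stp c) == p).

Lemma steady0 p k fut ed m nc o : safe m -> steady p 0 (Config k p fut ed m nc o).
Proof. by move=> sm [|i] //= _; rewrite sm eqxx. Qed.

Lemma steadyD p n1 n2 c c' :
  steady p n1 c -> iter n1 stp c = c' -> steady p n2 c' -> steady p (n1 + n2) c.
Proof.
move=> h1 E h2 i hi; case: (leqP i n1) => [/h1 //|ni].
by rewrite -(subnK (ltnW ni)) iterD E; apply: h2; lia.
Qed.

Lemma steadyS p n c : safe (memory c) -> post c = p -> steady p n (stp c) ->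
  steady p n.+1 c.
Proof.
by move=> sc pc h [|i] hi; [rewrite /= sc pc eqxx|rewrite iterSr; exact: h].
Qed.

(** A weakest precondition with a bound [tau] on the number of steps. The memory is
    required to be safe at every intermediate configuration, not only at the end,
    since the space bound concerns all of them; the phase [p] is tracked to tell
    which steps belong to the postprocessing. *)
Definition wp ed c M nc o tau Q : Prop :=
  forall m k p fut, nth 0 m =1 M -> safe m ->
  exists t m' M' nc' o',
    [/\ t <= tau,
        iter t stp (Config (c :: k) p fut ed m nc o) = Config k p fut ed m' nc' o',
        nth 0 m' =1 M' /\ Q M' nc' o' &
        steady p t (Config (c :: k) p fut ed m nc o)].

Lemma wp_one ed c M nc o Q m' M' nc' o' :
  (forall m k p fut, nth 0 m =1 M -> safe m ->
     [/\ stp (Config (c :: k) p fut ed m nc o) = Config k p fut ed (m' m) nc' o',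
         nth 0 (m' m) =1 M' & safe (m' m)]) ->
  Q M' nc' o' -> wp ed c M nc o 1 Q.
Proof.
move=> h q m k' p fut mM sm; have [E mM' sm'] := h m k' p fut mM sm.
exists 1, (m' m), M', nc', o'; split => //.
by apply: steadyS => //; rewrite E; exact: steady0.
Qed.

Lemma wp_skip ed M nc o Q : Q M nc o -> wp ed Skip M nc o 1 Q.
Proof. by apply: (wp_one (m' := id)) => m k p fut mM sm; split. Qed.

Lemma wp_assign ed a e M nc o Q : ev M ed a < N -> ev M ed e <= Bd ->
  Q (upd M (ev M ed a) (ev M ed e)) nc o -> wp ed (Assign a e) M nc o 1 Q.
Proof.
move=> aN eB.
apply: (wp_one (m' := fun m => set_nth 0 m (ev M ed a) (ev M ed e))).
move=> m k p fut mM sm; split; last exact: safe_set.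
  by rewrite /stp /step /= !(eval_ev _ _ mM).
exact: nth_set.
Qed.

Lemma wp_flip ed a M nc o Q : ev M ed a < N -> 0 < Bd ->
  Q (upd M (ev M ed a) (coin nc)) nc.+1 o -> wp ed (Flip a) M nc o 1 Q.
Proof.
move=> aN eB.
apply: (wp_one (m' := fun m => set_nth 0 m (ev M ed a) (coin nc))).
move=> m k p fut mM sm; split; last by apply: safe_set => //; case: (coin nc).
  by rewrite /stp /step /= !(eval_ev _ _ mM).
exact: nth_set.
Qed.

Lemma wp_emit ed e M nc o Q :
  Q M nc (rcons o (ev M ed e)) -> wp ed (Emit e) M nc o 1 Q.
Proof.
apply: (wp_one (m' := id)) => m k p fut mM sm; split => //.
by rewrite /stp /step /= !(eval_ev _ _ mM).
Qed.

Lemma wp_le ed c M nc o tau tau' Q Q' : wp ed c M nc o tau Q -> tau <= tau' ->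
  (forall M' nc' o', Q M' nc' o' -> Q' M' nc' o') -> wp ed c M nc o tau' Q'.
Proof.
move=> h le QQ' m k p fut mM sm.
have [t [m' [M' [nc' [o' [ht E [E' q] st]]]]]] := h m k p fut mM sm.
exists t, m', M', nc', o'; split => //; first exact: leq_trans le.
by split => //; exact: QQ'.
Qed.

Lemma steady_safe p n c : steady p n c -> safe (memory (iter n stp c)).
Proof. by move=> /(_ n (leqnn n)) /andP[]. Qed.

Lemma wp_then ed c1 c2 M nc o tau1 tau2 Q :
  wp ed c1 M nc o tau1 (fun M' nc' o' => wp ed c2 M' nc' o' tau2 Q) ->
  wp ed (Then c1 c2) M nc o (tau1 + tau2).+1 Q.
Proof.
move=> h m k p fut mM sm.
have [t1 [m1 [M1 [nc1 [o1 [ht1 E1 [mM1 h2] st1]]]]]] := h m (c2 :: k) p fut mM sm.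
have sm1 : safe m1 by have := steady_safe st1; rewrite E1.
have [t2 [m2 [M2 [nc2 [o2 [ht2 E2 [mM2 q] st2]]]]]] := h2 m1 k p fut mM1 sm1.
exists (t2 + t1).+1, m2, M2, nc2, o2; split => //; first by lia.
  by rewrite iterSr iterD E1 E2.
by apply: steadyS => //; rewrite addnC; apply: steadyD st2.
Qed.

Lemma wp_if ed e c1 c2 M nc o tau Q :
  wp ed (if ev M ed e != 0 then c1 else c2) M nc o tau Q ->
  wp ed (If e c1 c2) M nc o tau.+1 Q.
Proof.
move=> h m k p fut mM sm.
have [t1 [m1 [M1 [nc1 [o1 [ht1 E1 [mM1 h2] st1]]]]]] := h m k p fut mM sm.
have E : stp (Config (If e c1 c2 :: k) p fut ed m nc o) =
  Config ((if ev M ed e != 0 then c1 else c2) :: k) p fut ed m nc o.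
  by rewrite /stp /step /= (eval_ev _ _ mM).
exists t1.+1, m1, M1, nc1, o1; split => //; first by rewrite iterSr E.
by apply: steadyS => //; rewrite E.
Qed.

(** The invariant [I] is indexed by the number of completed iterations, of which
    [n] bounds the total. *)
Lemma wp_while ed e c n tau I M nc o Q :
  I 0 M nc o ->
  (forall i M nc o, i <= n -> I i M nc o ->
     if ev M ed e != 0 then i < n /\ wp ed c M nc o tau (I i.+1) else Q M nc o) ->
  wp ed (While e c) M nc o (n * tau.+1).+1 Q.
Proof.
move=> I0 hI.
suff gen d : forall i M nc o, i + d = n -> I i M nc o ->
    wp ed (While e c) M nc o (d * tau.+1).+1 Q by apply: (gen n 0).
elim: d => [|d IH] {I0} i {}M {}nc {}o id Ii m k p fut mM sm.
all: have h : i <= n by rewrite -id leq_addr.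
all: have {h} := hI i M nc o h Ii.
all: have E : stp (Config (While e c :: k) p fut ed m nc o) =
  Config (if ev M ed e != 0 then c :: While e c :: k else k) p fut ed m nc o
  by rewrite /stp /step /= (eval_ev _ _ mM).
all: case: ifP => [ee|ee q]; last first.
- exists 1, m, M, nc, o; split => //; first by rewrite /= E ee.
  by apply: steadyS => //; rewrite E ee; exact: steady0.
- by move=> [lt _]; rewrite -id addn0 ltnn in lt.
- exists 1, m, M, nc, o; split => //; first by rewrite /= E ee.
  by apply: steadyS => //; rewrite E ee; exact: steady0.
- move=> [_ hc].
  have [t1 [m1 [M1 [nc1 [o1 [ht1 E1 [mM1 h2] st1]]]]]] :=
    hc m (While e c :: k) p fut mM sm.
  have sm1 : safe m1 by have := steady_safe st1; rewrite E1.
  have id' : i.+1 + d = n by rewrite -id addSnnS.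
  have [t2 [m2 [M2 [nc2 [o2 [ht2 E2 [mM2 q] st2]]]]]] :=
    IH _ _ _ _ id' h2 m1 k p fut mM1 sm1.
  exists (t2 + t1).+1, m2, M2, nc2, o2; split => //.
  + by move: ht1 ht2; rewrite mulSn; lia.
  + by rewrite iterSr E ee iterD E1 E2.
  + by apply: steadyS => //; rewrite E ee addnC; apply: steadyD st2.
Qed.

(** A whole run: [P] is the invariant indexed by the edges already read, and [Q]
    the postcondition of the postprocessing, which starts after [t0] steps. *)
Lemma run_wp init s taus taue (P : seq (seq nat) -> store -> nat -> seq nat -> Prop) Q :
  safe init ->
  wp [::] (on_start A) (nth 0 init) 0 [::] taus (P [::]) ->
  (forall es e es', s = es ++ e :: es' -> forall M nc o, P es M nc o ->
     wp e (on_edge A) M nc o taus (P (rcons es e))) ->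
  (forall M nc o, P s M nc o -> wp [::] (on_end A) M nc o taue Q) ->
  (forall t, safe (memory (run A coin init s t))) /\
  exists t0 t1,
    [/\ forall t, t < t0 -> ~~ post (run A coin init s t), t1 <= taue,
        halted (run A coin init s (t0 + t1)) &
        exists M nc, Q M nc (output (run A coin init s (t0 + t1)))].
Proof.
move=> s0 hstart hedge hend; rewrite /run -/stp.
set c0 := Config _ _ _ _ _ _ _.
have [t1 [m1 [M1 [nc1 [o1 [_ E1 [mM1 P1] st1]]]]]] :=
  hstart init [::] false s (frefl _) s0.
have : forall suf es ed t m M nc o, s = es ++ suf ->
    iter t stp c0 = Config [::] false suf ed m nc o -> steady false t c0 ->
    nth 0 m =1 M -> P es M nc o ->
  exists t' ed' m' M' nc' o', [/\ iter t' stp c0 = Config [::] false [::] ed' m' nc' o',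
    steady false t' c0, nth 0 m' =1 M' & P s M' nc' o'].
  elim=> [|e suf IH] es ed t m M nc o sE Et st mM Pe.
    by exists t, ed, m, M, nc, o; split => //; rewrite sE cats0.
  have sm : safe m by have := steady_safe st; rewrite Et.
  have [t2 [m2 [M2 [nc2 [o2 [_ E2 [mM2 P2] st2]]]]]] :=
    hedge es e suf sE M nc o Pe m [::] false suf mM sm.
  apply: (IH (rcons es e) e (t2.+1 + t) m2 M2 nc2 o2) => //.
  - by rewrite cat_rcons.
  - by rewrite iterD Et iterSr E2.
  - rewrite addnC; apply: (steadyD st Et).
    by apply: steadyS.
move=> /(_ s [::] [::] t1 m1 M1 nc1 o1 erefl E1 st1 mM1 P1).
case=> t2 [ed [m [M [nc [o [E2 st2 mM Ps]]]]]].
have sm : safe m by have := steady_safe st2; rewrite E2.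
have [t3 [m3 [M3 [nc3 [o3 [le3 E3 [mM3 q] st3]]]]]] :=
  hend M nc o Ps m [::] true [::] mM sm.
have E2' : iter t2.+1 stp c0 = Config [:: on_end A] true [::] [::] m nc o.
  by rewrite iterS E2.
have E4 : iter (t2.+1 + t3) stp c0 = Config [::] true [::] [::] m3 nc3 o3.
  by rewrite addnC iterD E2' E3.
split; last first.
  exists t2.+1, t3; split => //; rewrite ?E4 //.
    by move=> t; rewrite ltnS => /st2 /andP[_ /eqP ->].
  by exists M3, nc3.
move=> t; case: (leqP t t2) => [/st2 /andP[] //|lt].
rewrite -(subnK lt) iterD E2'.
case: (leqP (t - t2.+1) t3) => [/st3 /andP[] //|lt3].
rewrite -(subnK (ltnW lt3)) iterD E3.
have sm3 : safe m3 by have := steady_safe st3; rewrite E3.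
suff -> : iter (t - t2.+1 - t3) stp (Config [::] true [::] [::] m3 nc3 o3)
  = Config [::] true [::] [::] m3 nc3 o3 by [].
by elim: (_ - _) => //= j ->.
Qed.

End Logic.

(** * The streaming program *)

Definition vr i := Cell (Const i).
Definition eAdd := BinOp OpAdd.
Definition eSub := BinOp OpSub.
Definition eMul := BinOp OpMul.
Definition eDiv := BinOp OpDiv.
Definition eEq := BinOp OpEq.
Definition eLeq := BinOp OpLeq.
Definition eLt x y := eLeq (eAdd x (Const 1)) y.
Definition ePow x p := iter p (eMul x) (Const 1).
Definition eAll (f : nat -> expr) m := foldr eMul (Const 1) [seq f t | t <- iota 0 m].
Definition put i e := Assign (Const i) e.
Definition incr i := put i (eAdd (vr i) (Const 1)).
Definition block (cs : seq cmd) := foldr Then Skip cs.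
Definition unroll (f : nat -> cmd) m := block [seq f t | t <- iota 0 m].

(** Cells 0 to 15 are scalars: 0..3 the inputs, 4 the palette size, 5 the number of
    blocks, 6 two to that power, 7 the block size, 8 the cap, 9 the number of stored
    events, 10 a loop counter, 11 to 13 a random number being drawn with its range
    and last bit, 14 a vertex and 15 the number of attempts made. Above them,
    [r + 4] arrays are interleaved, array [t] having its entry [x] at address
    [16 + t + (r + 4) * x]: 0 is the table, 1 the loads, 2 the partial coloring (0
    for blank, [j.+1] for block [j]), 3 the blocks of the events, and [4 + t] their
    [t]-th vertices. Interleaving lets all arrays grow without being sized in
    advance, and unwritten cells read as 0, which initializes the loads and the
    coloring. *)
Section Programs.
Variable r : nat.

Definition adr t x := eAdd (Const (16 + t)) (eMul (Const (r + 4)) x).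
Definition arr t x := Cell (adr t x).
Definition cell2 t v j := adr t (eAdd (eMul v (vr 5)) j).

(** The range in cell [b] is a power of two, so flipping its bits one by one gives a
    uniform number. *)
Definition draw b := block [:: put 11 (Const 0); put 12 (Const 1);
  While (eLt (vr 12) (vr b)) (block [:: Flip (Const 13);
    put 11 (eAdd (eMul (Const 2) (vr 11)) (vr 13));
    put 12 (eMul (Const 2) (vr 12))])].

Definition sizes := block [:: put 4 (Const 1);
  While (eLt (ePow (vr 4) r.-1) (eMul (Const (2 ^ (r + 18))) (vr 3)))
    (put 4 (eMul (Const 2) (vr 4)));
  put 5 (Const 1); put 6 (Const 2);
  While (eMul (eLt (vr 6) (eMul (eMul (Const 4) (vr 0)) (vr 0)))
              (eLt (vr 5) (vr 4)))
    (block [:: put 5 (eMul (Const 2) (vr 5)); put 6 (eMul (vr 6) (vr 6))]);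
  put 7 (eDiv (vr 4) (vr 5));
  put 8 (eDiv (ePow (vr 5) r.-1) (Const (2 ^ (r + 2))));
  put 10 (Const 0)].

Definition fill := While (eLt (vr 10) (eMul (vr 0) (vr 5)))
    (block [:: draw 7; Assign (adr 0 (vr 10)) (vr 11); incr 10]).

Definition start := Then sizes fill.

Definition vert t := EdgeVertex (Const t).

Definition read := block [:: put 10 (Const 0);
  While (eLt (vr 10) (vr 5)) (block [::
    If (eAll (fun t => eEq (Cell (cell2 0 (vert t) (vr 10)))
                           (Cell (cell2 0 (vert 0) (vr 10)))) r)
      (block [::
        unroll (fun t => Assign (cell2 1 (vert t) (vr 10))
           (eAdd (Cell (cell2 1 (vert t) (vr 10))) (Const 1))) r;
        If (eAll (fun t => eLeq (Cell (cell2 1 (vert t) (vr 10))) (vr 8)) r)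
          (block [:: Assign (adr 3 (vr 9)) (vr 10);
             unroll (fun t => Assign (adr (4 + t) (vr 9)) (vert t)) r;
             incr 9])
          Skip])
      Skip;
    incr 10])].

Definition find_blank := block [:: put 14 (Const 0);
  While (eMul (eLt (vr 14) (vr 0)) (eLt (Const 0) (arr 2 (vr 14)))) (incr 14)].

Definition mend := block [:: put 10 (Const 0);
  While (eLt (vr 10) (vr 9)) (block [::
    If (eAll (fun t => eEq (arr 2 (arr (4 + t) (vr 10)))
                           (eAdd (arr 3 (vr 10)) (Const 1))) r)
       (unroll (fun t => Assign (adr 2 (arr (4 + t) (vr 10))) (Const 0)) r)
       Skip;
    incr 10])].

Definition attempt_cmd := block [:: find_blank; draw 5;
  If (eMul (eLt (vr 14) (vr 0))
           (eLeq (Cell (cell2 1 (vr 14) (vr 11))) (vr 8)))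
     (Assign (adr 2 (vr 14)) (eAdd (vr 11) (Const 1)))
     Skip;
  mend; incr 15].

Definition tries := block [:: put 15 (Const 0);
  While (eLt (vr 15) (eMul (Const 10) (vr 0))) attempt_cmd].

Definition report := block [:: put 14 (Const 0);
  While (eLt (vr 14) (vr 0)) (block [::
    Emit (eAdd (eMul (eSub (arr 2 (vr 14)) (Const 1)) (vr 7))
      (Cell (cell2 0 (vr 14) (eSub (arr 2 (vr 14)) (Const 1)))));
    incr 14])].

Definition coloring_algorithm := Algorithm start read (Then tries report).
End Programs.

Section EvLemmas.
Variables (M : store) (ed : seq nat).
Lemma ev_vr i : ev M ed (vr i) = M i. Proof. by []. Qed.
Lemma ev_const c : ev M ed (Const c) = c. Proof. by []. Qed.
Lemma ev_cell a : ev M ed (Cell a) = M (ev M ed a). Proof. by []. Qed.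
Lemma ev_add x y : ev M ed (eAdd x y) = ev M ed x + ev M ed y. Proof. by []. Qed.
Lemma ev_sub x y : ev M ed (eSub x y) = ev M ed x - ev M ed y. Proof. by []. Qed.
Lemma ev_mul x y : ev M ed (eMul x y) = ev M ed x * ev M ed y. Proof. by []. Qed.
Lemma ev_div x y : ev M ed (eDiv x y) = ev M ed x %/ ev M ed y. Proof. by []. Qed.
Lemma ev_leq x y : ev M ed (eLeq x y) = (ev M ed x <= ev M ed y). Proof. by []. Qed.
Lemma ev_eq x y : ev M ed (eEq x y) = (ev M ed x == ev M ed y). Proof. by []. Qed.
Lemma ev_lt x y : ev M ed (eLt x y) = (ev M ed x < ev M ed y).
Proof. by rewrite /eLt ev_leq ev_add ev_const addn1. Qed.
Lemma ev_pow x p : ev M ed (ePow x p) = ev M ed x ^ p.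
Proof. by elim: p => //= p ->; rewrite expnS. Qed.
Lemma ev_vert t : ev M ed (vert t) = nth 0 ed t. Proof. by []. Qed.
Lemma ev_all f m :
  (ev M ed (eAll f m) != 0) = all (fun t => ev M ed (f t) != 0) (iota 0 m).
Proof.
rewrite /eAll; elim: (iota 0 m) => //= t s <-.
by rewrite muln_eq0 negb_or.
Qed.
End EvLemmas.

Lemma b2n (b : bool) : (b != 0 :> nat) = b. Proof. by case: b. Qed.
Lemma b2n2 (b c : bool) : (b * c != 0 :> nat) = b && c. Proof. by case: b; case: c. Qed.

Section Addresses.
Variable r : nat.
Definition addr t x := 16 + t + (r + 4) * x.

Lemma addr_eq t t' x y : t < r + 4 -> t' < r + 4 ->
  (addr t x == addr t' y) = (t == t') && (x == y).
Proof.
move=> ht ht'; apply/eqP/andP => [|[/eqP-> /eqP->] //].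
rewrite /addr -!addnA => /addnI; rewrite !(addnC _ ((r + 4) * _)) !(mulnC (r + 4)).
move=> E; have s0 : 0 < r + 4 by lia.
have := congr1 (divn^~ (r + 4)) E; have := congr1 (modn^~ (r + 4)) E.
rewrite !modnMDl !divnMDl // !modn_small // !divn_small // !addn0.
by move=> -> ->.
Qed.

Lemma addr_high t x : 16 <= addr t x.
Proof. by rewrite /addr -addnA leq_addr. Qed.

Lemma addr_scalar t x i : i < 16 -> (addr t x == i) = false.
Proof. by move=> i16; apply/negbTE; rewrite neq_ltn (leq_trans i16 (addr_high t x)) orbT. Qed.

Lemma scalar_addr t x i : i < 16 -> (i == addr t x) = false.
Proof. by rewrite eq_sym; exact: addr_scalar. Qed.

Lemma ev_adr M ed t x : ev M ed (adr r t x) = addr t (ev M ed x).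
Proof. by []. Qed.

Lemma ev_cell2 M ed t v j :
  ev M ed (cell2 r t v j) = addr t (ev M ed v * M 5 + ev M ed j).
Proof. by []. Qed.
End Addresses.
Definition evE := (ev_adr, ev_cell2, ev_vr, ev_const, ev_add, ev_sub, ev_mul,
  ev_div, ev_leq, ev_eq, ev_lt, ev_pow, ev_vert, ev_cell).

Lemma pair_index_eq l v v' j j' : j < l -> j' < l ->
  (v * l + j == v' * l + j') = (v == v') && (j == j').
Proof.
move=> hj hj'; apply/eqP/andP => [E|[/eqP-> /eqP->] //].
have l0 : 0 < l by lia.
have := congr1 (divn^~ l) E; have := congr1 (modn^~ l) E.
rewrite !modnMDl !divnMDl // !modn_small // !divn_small // !addn0.
by move=> -> ->.
Qed.

Section Blocks.
Variables (A : algorithm) (coin : nat -> bool) (N Bd : nat).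
Notation wp := (wp A coin N Bd).

Lemma wp_tau ed c M nc o tau tau' Q : wp ed c M nc o tau Q -> tau <= tau' ->
  wp ed c M nc o tau' Q.
Proof. by move=> h le; exact: wp_le h le _. Qed.

Lemma wp_conseq ed c M nc o tau (Q Q' : store -> nat -> seq nat -> Prop) :
  wp ed c M nc o tau Q -> (forall M nc o, Q M nc o -> Q' M nc o) ->
  wp ed c M nc o tau Q'.
Proof. by move=> h; exact: wp_le h (leqnn _). Qed.

Lemma wp_cons ed c cs M nc o tau1 tau2 Q :
  wp ed c M nc o tau1 (fun M' nc' o' => wp ed (block cs) M' nc' o' tau2 Q) ->
  wp ed (block (c :: cs)) M nc o (tau1 + tau2).+1 Q.
Proof. exact: wp_then. Qed.

Lemma wp_nil ed M nc o (Q : store -> nat -> seq nat -> Prop) :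
  Q M nc o -> wp ed (block [::]) M nc o 1 Q.
Proof. exact: wp_skip. Qed.

Lemma wp_unroll ed f m tau (J : nat -> store -> nat -> seq nat -> Prop) M nc o :
  J 0 M nc o ->
  (forall t M nc o, t < m -> J t M nc o -> wp ed (f t) M nc o tau (J t.+1)) ->
  wp ed (unroll f m) M nc o (m * tau.+1).+1 (J m).
Proof.
move=> J0 hJ; rewrite /unroll.
suff gen d : forall t M nc o, t + d = m -> J t M nc o ->
    wp ed (block [seq f t | t <- iota t d]) M nc o (d * tau.+1).+1 (J m).
  exact: (gen m 0).
elim: d => [|d IH] {J0} t {}M {}nc {}o td Jt.
  by apply: wp_nil; rewrite -td addn0.
apply: (wp_tau (tau := (tau + (d * tau.+1).+1).+1)); last by rewrite mulSn; lia.
apply: wp_cons; apply: wp_conseq (hJ t _ _ _ _ Jt) _; first by lia.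
by move=> M' nc' o'; apply: IH; rewrite addSnnS.
Qed.

Lemma wp_put ed i e M nc o (Q : store -> nat -> seq nat -> Prop) : i < N -> ev M ed e <= Bd ->
  Q (upd M i (ev M ed e)) nc o -> wp ed (put i e) M nc o 1 Q.
Proof. by move=> iN eB q; apply: wp_assign. Qed.

Lemma draw_wp ed b w M nc o : b < 10 -> M b = 2 ^ w -> 2 ^ w <= Bd -> 16 <= N ->
  wp ed (draw b) M nc o (8 * w + 20) (fun M' nc' o' =>
    [/\ nc' = nc + w, o' = o, M' 11 = digit coin nc w &
        forall a, a \notin [:: 11; 12; 13] -> M' a = M a]).
Proof.
move=> b10 Mb wB hN; have B0 : 0 < Bd by apply: leq_trans wB; rewrite expn_gt0.
have hN' i : i < 16 -> i < N by move=> h; exact: leq_trans hN.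
eapply wp_tau.
  apply: wp_cons; apply: wp_put; rewrite ?evE ?hN' //.
  apply: wp_cons; apply: wp_put; rewrite ?evE ?hN' //.
  apply: wp_cons; eapply (wp_conseq (Q := fun M' nc' o' =>
    [/\ nc' = nc + w, o' = o, M' 11 = digit coin nc w &
        forall a, a \notin [:: 11; 12; 13] -> M' a = M a])); last first.
    by move=> M' nc' o' h; apply: wp_nil.
  apply: (wp_while (n := w) (tau := 7) (I := fun i M' nc' o' =>
    [/\ nc' = nc + i, o' = o, M' 11 = digit coin nc i /\ M' 12 = 2 ^ i &
        forall a, a \notin [:: 11; 12; 13] -> M' a = M a])).
    split; rewrite ?addn0 //; move=> a; rewrite !inE !negb_or /upd.
    by move=> /and3P[/negbTE -> /negbTE -> _].
  move=> i M' nc' o' iw [-> -> [e11 e12] fr]; rewrite evE b2n !evE e12.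
  have bn : b \notin [:: 11; 12; 13] by rewrite !inE; lia.
  rewrite (fr _ bn) Mb ltn_exp2l //; case: ltnP => iw'; last first.
    have -> : w = i by lia.
    by [].
  split => //; apply: (wp_tau (tau := (1 + (1 + (1 + 1).+1).+1).+1)) => //.
  have h2 : 2 * digit coin nc i + coin (nc + i) < 2 ^ i.+1 := digit_lt coin nc i.+1.
  have h3 : 2 ^ i.+1 <= 2 ^ w by rewrite leq_exp2l.
  apply: wp_cons; apply: wp_flip; rewrite ?evE ?hN' //.
  apply: wp_cons; apply: wp_put; rewrite ?evE ?hN' //.
    by rewrite /upd /= e11; lia.
  apply: wp_cons; apply: wp_put; rewrite ?evE ?hN' //.
    by rewrite /upd /= e12 -expnS; lia.
  apply: wp_nil; split => //; first by rewrite addnS.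
    by rewrite /upd /= e11 e12 -expnS.
  move=> a ha; rewrite -fr // /upd.
  by move: ha; rewrite !inE !negb_or => /and3P[/negbTE -> /negbTE -> /negbTE ->].
lia.
Qed.

End Blocks.

(** * Correctness of the program *)

Section Correctness.
Variables (A : algorithm) (coin : nat -> bool).
Variables (n r k Delta : nat).
Hypothesis r_ge2 : 1 < r.
Hypothesis n_gt1 : 1 < n.
Let l := nlist n r Delta.
Let a := aexp n r Delta.
Let b := bexp n r Delta.
Let B := nbase n r Delta.
Let D := cap n r Delta.
Let q := 2 ^ mexp r Delta.
Let X := @coin_table n r Delta coin.

(** Bounds on the number of cells and on their contents. *)
Definition cells := 16 + (r + 4) * (n * l * D.+1).
Definition peak := q + 2 ^ l + D + n * l * D.+1 + 10 * n + Delta + r + k + 4.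

Notation wp := (wp A coin cells peak).
Let event := (seq 'I_n * 'I_l)%type.
Implicit Types (ld : 'I_l -> 'I_n -> nat) (evs : seq event) (col : 'I_n -> nat).
Implicit Types (v : 'I_n) (j : 'I_l) (M : store).

Let l_gt0 : 0 < l := nlist_gt0 n r Delta.
Let B_gt0 : 0 < B := nbase_gt0 n r Delta.
Let qE : q = l * B := palette_split n r Delta.
Let n_gt0 : 0 < n := ltnW n_gt1.

Record Consts M : Prop := {
  c0 : M 0 = n; c4 : M 4 = q; c5 : M 5 = l; c7 : M 7 = B; c8 : M 8 = D }.

(** The memory represents the loads [ld], the events [evs] and the encoded partial
    coloring [col]; the scalars from 10 to 15 are left free. *)
Record Inv ld evs col M : Prop := {
  ic : Consts M;
  i9 : M 9 = size evs;
  iX : forall v j, M (addr r 0 (v * l + j)) = X j v;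
  iL : forall v j, M (addr r 1 (v * l + j)) = ld j v;
  iC : forall v, M (addr r 2 v) = col v;
  iE : forall E i, i < size evs -> M (addr r 3 i) = (nth E evs i).2 /\
    forall t, t < r -> M (addr r (4 + t) i) = nth 0 (map val (nth E evs i).1) t }.

Definition scratch x := (9 < x) && (x < 16).

Lemma inv_frame ld evs col M M' : Inv ld evs col M ->
  (forall x, ~~ scratch x -> M' x = M x) -> Inv ld evs col M'.
Proof.
move=> [[]] ? ? ? ? ? h9 hX hL hC hE fr.
have fa t x : M' (addr r t x) = M (addr r t x).
  by apply: fr; rewrite /scratch negb_and -!leqNgt (addr_high r t x) orbT.
split; [split| |move=> w i|move=> w i|move=> w|move=> E i H].
1-9: by rewrite ?fa ?fr.
have [h1 h2] := hE E i H; split=> [|t tr]; rewrite fa //; exact: h2.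
Qed.

Lemma inv_put ld evs col M i x : Inv ld evs col M -> scratch i ->
  Inv ld evs col (upd M i x).
Proof.
by move=> h hi; apply: (inv_frame h) => y; rewrite /upd; case: eqP => // ->; rewrite hi.
Qed.

Lemma inv_col ld evs col M (v : 'I_n) x : Inv ld evs col M ->
  Inv ld evs (fun w => if w == v then x else col w) (upd M (addr r 2 v) x).
Proof.
move=> [[]] ? ? ? ? ? h9 hX hL hC hE.
have ne t y : t < r + 4 -> t != 2 -> (addr r t y == addr r 2 v) = false.
  by move=> ht /negbTE t2; rewrite addr_eq ?t2 //; lia.
split; [split| |move=> w i|move=> w i|move=> w|move=> E i H].
1-6: by rewrite /upd scalar_addr.
- by rewrite /upd ne //; lia.
- by rewrite /upd ne //; lia.
- by rewrite /upd addr_eq ?hC //; lia.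
have [h1 h2] := hE E i H; split; first by rewrite /upd ne //; lia.
by move=> t tr; rewrite /upd ne ?h2 //; lia.
Qed.

Lemma inv_load ld evs col M (v : 'I_n) (j : 'I_l) x : Inv ld evs col M ->
  Inv (fun i w => if (w == v) && (i == j) then x else ld i w) evs col
    (upd M (addr r 1 (v * l + j)) x).
Proof.
move=> [[]] ? ? ? ? ? h9 hX hL hC hE.
have ne t y : t < r + 4 -> t != 1 -> (addr r t y == addr r 1 (v * l + j)) = false.
  by move=> ht /negbTE t2; rewrite addr_eq ?t2 //; lia.
split; [split| |move=> w i|move=> w i|move=> w|move=> E i H].
1-6: by rewrite /upd scalar_addr.
- by rewrite /upd ne //; lia.
- by rewrite /upd addr_eq ?pair_index_eq ?hL //; lia.
- by rewrite /upd ne //; lia.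
have [h1 h2] := hE E i H; split; first by rewrite /upd ne //; lia.
by move=> t tr; rewrite /upd ne ?h2 //; lia.
Qed.

Lemma inv_event ld evs col M t x : Inv ld evs col M -> 2 < t < r + 4 ->
  Inv ld evs col (upd M (addr r t (size evs)) x).
Proof.
move=> [[]] ? ? ? ? ? h9 hX hL hC hE /andP[t2 tr].
have ne u y : u < r + 4 -> u != t -> (addr r u y == addr r t (size evs)) = false.
  by move=> ht /negbTE t2'; rewrite addr_eq ?t2' //; lia.
split; [split| |move=> w i|move=> w i|move=> w|move=> E i H].
1-6: by rewrite /upd scalar_addr.
- by rewrite /upd ne //; lia.
- by rewrite /upd ne //; lia.
- by rewrite /upd ne //; lia.
have [h1 h2] := hE E i H; split.
  by rewrite /upd addr_eq ?(ltn_eqF H) ?andbF //; lia.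
by move=> u ur; rewrite /upd addr_eq ?(ltn_eqF H) ?andbF ?h2 //; lia.
Qed.

Lemma inv_push ld evs col M (E : event) : Inv ld evs col M ->
  M (addr r 3 (size evs)) = E.2 ->
  (forall t, t < r -> M (addr r (4 + t) (size evs)) = nth 0 (map val E.1) t) ->
  Inv ld (rcons evs E) col (upd M 9 (size evs).+1).
Proof.
move=> [[]] ? ? ? ? ? h9 hX hL hC hE e3 e4.
split; [split| |move=> w i|move=> w i|move=> w|move=> E0 i H].
1-5: by [].
- by rewrite size_rcons.
1-3: by rewrite /upd addr_scalar.
move: H; rewrite size_rcons ltnS leq_eqVlt nth_rcons => /predU1P[->|iE'].
  by rewrite ltnn eqxx /upd; split=> [|t tr]; rewrite addr_scalar ?e4.
rewrite iE'; have [h1 h2] := hE E0 i iE'; rewrite /upd.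
by split=> [|t tr]; rewrite addr_scalar ?h2.
Qed.

Lemma small i : i < 16 -> i < cells.
Proof. by move=> h; rewrite /cells (leq_trans h) // leq_addr. Qed.

Lemma tiny x : x <= 4 -> x <= peak.
Proof. by move=> h; rewrite /peak (leq_trans h) // leq_addl. Qed.

Lemma peakP : [/\ q <= peak, 2 ^ l <= peak, D <= peak, n * l * D.+1 <= peak &
  10 * n + Delta <= peak].
Proof.
by rewrite /peak; move: (2 ^ l) (n * l * _) (10 * n) => x y z; split; lia.
Qed.

Lemma addr_cells t x : t < r + 4 -> x < n * l * D.+1 -> addr r t x < cells.
Proof.
move=> ht hx; rewrite /addr /cells -addnA ltn_add2l.
apply: leq_trans (_ : (r + 4) * x.+1 <= _); first by rewrite mulnS; lia.
by rewrite leq_mul2l hx orbT.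
Qed.

Lemma pair_lt v j : v * l + j < n * l.
Proof.
have := ltn_ord v; have := ltn_ord j; move: (val v) (val j) => x y yl xn.
by apply: leq_trans (_ : x.+1 * l <= _); [rewrite mulSn; lia|rewrite leq_mul2r xn orbT].
Qed.

Lemma pair_cells t v j : t < 3 -> addr r t (v * l + j) < cells.
Proof.
move=> t3; apply: addr_cells; first by lia.
by apply: leq_trans (pair_lt v j) _; rewrite leq_pmulr.
Qed.

Lemma vertex_cells v : addr r 2 v < cells.
Proof.
apply: addr_cells; first by lia.
by apply: leq_trans (ltn_ord v) _; rewrite -mulnA leq_pmulr ?muln_gt0 ?l_gt0.
Qed.

Lemma event_cells t i : t < r + 4 -> i < n * (l * D) -> addr r t i < cells.
Proof.
move=> ht hi; apply: addr_cells => //; apply: leq_trans hi _.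
by rewrite mulnA leq_mul2l leqnSn orbT.
Qed.

Lemma X_lt j v : X j v < B. Proof. exact: digit_lt. Qed.

Lemma l_le_q : l <= q. Proof. by rewrite qE leq_pmulr. Qed.
Lemma B_le_q : B <= q. Proof. by rewrite qE leq_pmull. Qed.
Lemma l_le_2l : l < 2 ^ l. Proof. exact: ltn_expl. Qed.
Lemma nl_peak : n * l <= n * l * D.+1. Proof. by rewrite leq_pmulr. Qed.

Ltac peak_lia := have [? ? ? ? ?] := peakP; lia.

Lemma sizes_wp M nc o : M 0 = n -> M 3 = Delta -> (forall x, 3 < x -> M x = 0) ->
  wp [::] (sizes r) M nc o (2 * mexp r Delta + 10 * a + 40) (fun M' nc' o' =>
    [/\ nc' = nc, o' = o, Consts M', M' 9 = 0 & M' 10 = 0 /\ forall x, 15 < x -> M' x = 0]).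
Proof.
move=> M0 M3 Mz; rewrite /sizes; eapply wp_tau.
apply: wp_cons; apply: wp_put; rewrite ?evE ?small //; try exact: tiny.
apply: wp_cons; eapply (wp_conseq (Q := fun M' nc' o' =>
    [/\ nc' = nc, o' = o, M' 4 = q & forall x, x != 4 -> M' x = M x])).
  apply: (wp_while (n := mexp r Delta) (tau := 1) (I := fun i M' nc' o' =>
    [/\ nc' = nc, o' = o, M' 4 = 2 ^ i & forall x, x != 4 -> M' x = M x])).
    by split=> // x /negbTE h; rewrite /upd h.
  move=> i M' nc' o' im [-> -> e4 fr]; rewrite evE b2n !evE e4 fr // M3.
  have -> : ((2 ^ i) ^ r.-1 < 2 ^ (r + 18) * Delta) = (i < mexp r Delta).
    rewrite -expnM mulnC expnM; apply/idP/idP => h; last first.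
      rewrite ltnNge; apply: contraL h => h; rewrite -leqNgt.
      by apply: up_log_min h; exact: base_gt1.
    rewrite ltnNge; apply: contraL h => h; rewrite -leqNgt.
    apply: leq_trans (up_logP _ (base_gt1 r_ge2)) _.
    by rewrite leq_exp2l ?base_gt1.
  case: ltnP => h; last by have -> : q = 2 ^ i by congr (_ ^ _); lia.
  split=> //; apply: wp_put; rewrite ?evE ?small //; try exact: tiny.
    rewrite e4 -expnS; apply: leq_trans (_ : q <= _); first by rewrite leq_exp2l.
    by peak_lia.
  split=> //; rewrite /upd /= ?e4 -?expnS // => x /negbTE h'.
  by rewrite h' fr // h'.
move=> {}M1 {}nc1 {}o1 [-> -> e4 fr].
apply: wp_cons; apply: wp_put; rewrite ?evE ?small //; try exact: tiny.
apply: wp_cons; apply: wp_put; rewrite ?evE ?small //; try exact: tiny.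
apply: wp_cons; eapply (wp_conseq (Q := fun M' nc' o' =>
    [/\ nc' = nc, o' = o, M' 5 = l & forall x, x != 5 -> x != 6 -> M' x = M1 x])).
  apply: (wp_while (n := a) (tau := (1 + (1 + 1).+1).+1) (I := fun i M' nc' o' =>
    [/\ nc' = nc, o' = o, M' 5 = 2 ^ i /\ M' 6 = 2 ^ (2 ^ i) &
        forall x, x != 5 -> x != 6 -> M' x = M1 x])).
    by split=> // x /negbTE h5 /negbTE h6; rewrite /upd h5 h6.
  move=> i M' nc' o' im [-> -> [e5 e6] fr2].
  rewrite evE !evE b2n2 e5 e6 !fr2 // e4 fr // M0.
  have -> : (2 ^ 2 ^ i < 4 * n * n) && (2 ^ i < q) = (i < a).
    rewrite /q ltn_exp2l // andbC /a /aexp leq_min; congr (_ && _).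
    apply/idP/idP => h.
      rewrite ltnNge; apply: contraL h => h; rewrite -leqNgt.
      apply: leq_trans (up_logP _ (isT : 1 < 2)) _.
      rewrite leq_exp2l //; apply: leq_trans (up_logP _ (isT : 1 < 2)) _.
      by rewrite leq_exp2l.
    rewrite ltnNge; apply: contraL h => h; rewrite -leqNgt.
    apply: up_log_min => //; apply: up_log_min => //.
  case: ltnP => h; last by have -> : l = 2 ^ i by congr (_ ^ _); lia.
  have hl : 2 ^ i.+1 <= l by rewrite leq_exp2l.
  have hl2 : 2 ^ (2 ^ i.+1) <= 2 ^ l by rewrite leq_exp2l.
  have := l_le_2l => hll.
  split=> //; apply: wp_cons; apply: wp_put; rewrite ?evE ?small //; try exact: tiny.
    by rewrite e5 -expnS; peak_lia.
  apply: wp_cons; apply: wp_put; rewrite ?evE ?small //; try exact: tiny.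
    by rewrite /upd /= e6 -expnD addnn -mul2n -expnS; peak_lia.
  apply: wp_nil; split=> //.
    by rewrite /upd /= e5 e6 -expnD addnn -mul2n -expnS.
  by move=> x h5 h6; rewrite -fr2 // /upd (negbTE h5) (negbTE h6).
move=> {}M2 {}nc2 {}o2 [-> -> e5 fr2].
apply: wp_cons; apply: wp_put; rewrite ?evE ?small //; try exact: tiny.
  by rewrite fr2 // e4 e5 qE mulKn //; have := B_le_q; peak_lia.
apply: wp_cons; apply: wp_put; rewrite ?evE ?small //; try exact: tiny.
  by rewrite /upd /= e5 -[_ %/ _]/D; peak_lia.
apply: wp_cons; apply: wp_put; rewrite ?evE ?small //; try exact: tiny.
apply: wp_nil; split=> //.
- split; rewrite /upd /=.
  + by rewrite fr2 // fr.
  + by rewrite fr2.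
  + by [].
  + by rewrite fr2 // e4 e5 qE mulKn.
  + by rewrite e5.
- by rewrite /upd /= fr2 // fr // Mz.
- split=> // x x15; rewrite /upd.
  have ne i : i < 16 -> (x == i) = false by lia.
  rewrite !ne //= fr2 ?ne // fr ?ne // Mz //; lia.
lia.
Qed.

Lemma fill_wp M nc o : Consts M -> M 9 = 0 -> M 10 = 0 ->
    (forall x, 15 < x -> M x = 0) -> nc = 0 ->
  wp [::] (fill r) M nc o ((n * l) * (8 * b + 20 + 10).+1).+1 (fun M' nc' o' =>
    [/\ Inv (fun _ _ => 0) [::] (fun=> 0) M', nc' = choice_start n r Delta & o' = o]).
Proof.
move=> cM M9 M10 Mz ->.
eapply (wp_conseq (Q := fun M' nc' o' =>
  [/\ Consts M' /\ M' 9 = 0, nc' = n * l * b, o' = o &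
     forall t x, t < r + 4 -> M' (addr r t x) =
       if (t == 0) && (x < n * l) then digit coin (x * b) b else 0])); last first.
  move=> M' nc' o' [[cM' M9'] -> -> hA].
  split=> //; split=> // *; rewrite hA ?eqxx ?pair_lt //; lia.
apply: (wp_while (n := n * l) (I := fun i M' nc' o' =>
  [/\ [/\ Consts M', M' 9 = 0 & M' 10 = i], nc' = i * b, o' = o &
     forall t x, t < r + 4 -> M' (addr r t x) =
       if (t == 0) && (x < i) then digit coin (x * b) b else 0])).
  split=> // t x _; rewrite ltn0 andbF Mz //; exact: addr_high.
move=> i M' nc' o' ile [[cM' M9' M10'] -> -> hA].
rewrite evE b2n !evE M10' (c0 cM') (c5 cM'); case: ltnP => hi; last first.
  by have -> : n * l = i by lia.
split=> //; eapply wp_tau.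
  apply: wp_cons; apply: wp_conseq.
    apply: (@draw_wp A coin cells peak [::] 7 b M' (i * b) o); rewrite ?(c7 cM') //.
    by apply: leq_trans B_le_q _; peak_lia.
  move=> M2 nc2 o2 [-> -> M11 fr].
  have frs x : x \notin [:: 11; 12; 13] -> M2 x = M' x by exact: fr.
  have fra t x : M2 (addr r t x) = M' (addr r t x).
    by apply: fr; rewrite !inE !addr_scalar.
  apply: wp_cons; apply: wp_assign.
  - rewrite ev_adr evE frs // M10'; apply: addr_cells; first by lia.
    exact: leq_trans hi nl_peak.
  - rewrite evE M11; have h : digit coin (i * b) b < B := digit_lt coin (i * b) b.
    by have hB := B_le_q; peak_lia.
  apply: wp_cons; apply: wp_put; rewrite ?small //.
    rewrite !evE /upd scalar_addr // frs // M10'.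
    by have h := nl_peak; peak_lia.
  rewrite !evE; apply: wp_nil; rewrite M11 frs // M10'; split => //.
  - split; rewrite /upd /= ?scalar_addr //=.
    + case: cM' => *; split; rewrite /= ?scalar_addr //= frs //.
    + by rewrite frs.
    + by rewrite frs // M10' addn1.
  - by rewrite mulSn addnC.
  - move=> t x tr; rewrite /upd addr_scalar //= addr_eq //; last by lia.
    rewrite fra hA //; case: (t == 0) => //=; rewrite ltnS.
    by case: (ltngtP x i) => // ->.
lia.
Qed.

Lemma inv_ext ld ld' evs evs' col col' M : Inv ld evs col M ->
  (forall j v, ld j v = ld' j v) -> evs = evs' -> (forall v, col v = col' v) ->
  Inv ld' evs' col' M.
Proof.
move=> [? ? ? hL hC ?] hld <- hcol; split=> // *; first by rewrite hL hld.
by rewrite hC hcol.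
Qed.

Let v0 : 'I_n := Ordinal n_gt0.

Lemma nth_val (e : seq 'I_n) t : t < size e -> nth 0 (map val e) t = nth v0 e t.
Proof. by move=> te; rewrite (nth_map v0). Qed.

Lemma all_iota (e : seq 'I_n) (P : pred 'I_n) (Q : pred nat) : r <= size e ->
  (forall t, t < r -> Q t = P (nth v0 e t)) -> all Q (iota 0 r) = all P (take r e).
Proof.
move=> re h; rewrite -(map_nth_iota0 v0 re) all_map; apply: eq_in_all => t.
by rewrite mem_iota => /andP[_ tr]; rewrite /= h.
Qed.

Lemma clashE f e : r <= size e ->
  clash r f e = all (fun u => f u == f (nth v0 e 0)) (take r e).
Proof.
move=> re; rewrite /clash; case: e re => [|u e] /=.
  by rewrite leqn0 => /eqP r0; move: r_ge2; rewrite r0.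
by case: (r) (ltnW r_ge2) => //= m _ _; rewrite eqxx all_map.
Qed.

Lemma mem_take_nth (e : seq 'I_n) t v : t < size e ->
  (v \in take t.+1 e) = (v == nth v0 e t) || (v \in take t e).
Proof. by move=> te; rewrite (take_nth v0) // mem_rcons inE. Qed.

Lemma nth_notin_take (e : seq 'I_n) t : uniq e -> t < size e ->
  (nth v0 e t \in take t e) = false.
Proof.
move=> ue te; have := take_uniq t.+1 ue.
by rewrite (take_nth v0) // rcons_uniq => /andP[/negbTE].
Qed.

Section Read.
Variables (es : seq (seq 'I_n)) (e : seq 'I_n).
Hypothesis e_uniq : uniq e.
Hypothesis e_size : r <= size e.
Let es' := rcons es e.
Hypothesis load_le : forall j v, load r (X j) es' v <= Delta.
Hypothesis events_le : size (events r D X es') <= n * (l * D).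

(** The loads and the events when blocks below [i] have been processed for [e]. *)
Let hits i j v := load r (X j) es v + [&& j < i, clash r (X j) e & v \in take r e].
Let found i : seq event := events r D X es ++
  [seq (take r e, j) | j <- take i (enum 'I_l) & kept r D X es' e j].

Lemma found_end : found l = events r D X es'.
Proof. by rewrite events_rcons /found [take l _]take_oversize // size_enum_ord. Qed.

Lemma foundS i (h : i < l) (j := Ordinal h) :
  found i.+1 = if kept r D X es' e j then rcons (found i) (take r e, j) else found i.
Proof.
rewrite /found (take_nth j) ?size_enum_ord // (nth_ord_enum j j) filter_rcons.
by case: ifP => //; rewrite map_rcons -rcons_cat.
Qed.

Lemma found_size i (h : i < l) : kept r D X es' e (Ordinal h) ->
  size (found i) < n * (l * D).
Proof.
move=> hk; apply: leq_trans events_le; rewrite -found_end.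
have <- : size (found i.+1) = (size (found i)).+1 by rewrite foundS hk size_rcons.
rewrite /found !size_cat leq_add2l !size_map !size_filter.
rewrite [take l _]take_oversize ?size_enum_ord //.
by rewrite -[in leqRHS](cat_take_drop i.+1 (enum 'I_l)) count_cat leq_addr.
Qed.

Lemma hits_now j v : hits j.+1 j v = load r (X j) es' v.
Proof. by rewrite /hits load_rcons ltnSn. Qed.

Let live i (nc : nat) (o : seq nat) M' nc' o' :=
  [/\ Inv (hits i) (found i) (fun=> 0) M', M' 10 = i, nc' = nc & o' = o].

Lemma bump_wp i (h : i < l) (j := Ordinal h) M nc o :
  clash r (X j) e -> Inv (hits i) (found i) (fun=> 0) M -> M 10 = i ->
  wp (map val e) (unroll (fun t => Assign (cell2 r 1 (vert t) (vr 10))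
           (eAdd (Cell (cell2 r 1 (vert t) (vr 10))) (Const 1))) r)
    M nc o (r * 2).+1 (fun M' nc' o' =>
      [/\ Inv (hits i.+1) (found i) (fun=> 0) M', M' 10 = i, nc' = nc & o' = o]).
Proof.
move=> cl hM M10; apply: (wp_conseq (Q := fun M' nc' o' =>
   [/\ Inv (fun j' v => hits i j' v + ((j' == j) && (v \in take r e))) (found i) (fun=> 0) M',
       M' 10 = i, nc' = nc & o' = o])); last first.
  move=> M' nc' o' [hM' -> -> ->]; split=> //; apply: (inv_ext hM') => // j' v.
  rewrite /hits ltnS (leq_eqVlt j') -(inj_eq val_inj) /=.
  case: (eqVneq (val j') i) => [ji|] /=; last by rewrite addn0.
  have -> : j' = j by apply: val_inj; rewrite /= ji.
  by rewrite /= ltnn cl addn0.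
apply: (wp_unroll (J := fun t M' nc' o' =>
   [/\ Inv (fun j' v => hits i j' v + ((j' == j) && (v \in take t e))) (found i) (fun=> 0) M',
       M' 10 = i, nc' = nc & o' = o])).
  by split=> //; apply: (inv_ext hM) => // j' v; rewrite take0 andbF addn0.
move=> t M' nc' o' tr [hM' M'10 -> ->].
have te : t < size e by exact: leq_trans tr e_size.
set u := nth v0 e t.
have uval : nth 0 (map val e) t = u by rewrite nth_val.
have cellE : ev M' (map val e) (cell2 r 1 (vert t) (vr 10)) = addr r 1 (u * l + j).
  by rewrite !evE uval (c5 (ic hM')) M'10.
have ldE : M' (addr r 1 (u * l + j)) = load r (X j) es u.
  by rewrite (iL hM') /hits ltnn nth_notin_take // andbF !addn0.
have uin : u \in take r e.
  by rewrite /u -(nth_take v0 tr) mem_nth // size_takel.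
apply: wp_assign; rewrite ?cellE.
- exact: pair_cells.
- rewrite ev_add ev_cell cellE ldE ev_const.
  have := load_le j u; rewrite /es' load_rcons cl uin; peak_lia.
split=> //.
rewrite ev_add ev_cell cellE ldE ev_const.
apply: (inv_ext (inv_load u j _ hM')) => // j' v.
rewrite mem_take_nth // -/u; case: (eqVneq j' j) => [->|]; last by rewrite andbF.
rewrite andbT /=; case: eqVneq => [->|] //=.
by rewrite /hits /= ltnn addn0.
Qed.

Lemma store_wp i (h : i < l) (j := Ordinal h) M nc o :
  kept r D X es' e j -> Inv (hits i.+1) (found i) (fun=> 0) M -> M 10 = i ->
  wp (map val e) (block [:: Assign (adr r 3 (vr 9)) (vr 10);
             unroll (fun t => Assign (adr r (4 + t) (vr 9)) (vert t)) r;
             incr 9]) M nc o (2 * r + 10)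
   (fun M' nc' o' =>
      [/\ Inv (hits i.+1) (found i.+1) (fun=> 0) M', M' 10 = i, nc' = nc & o' = o]).
Proof.
move=> hk hM M10; have hs := found_size hk; set s := size (found i) in hs.
have nlD : n * (l * D) <= n * l * D.+1 by rewrite mulnA leq_mul2l leqnSn orbT.
have hl := l_le_2l.
eapply wp_tau.
  apply: wp_cons; apply: wp_assign; rewrite ?evE ?(i9 hM) -?/s.
  - by apply: event_cells => //; lia.
  - by rewrite M10; peak_lia.
  rewrite M10.
  apply: wp_cons; apply: wp_conseq.
    apply: (wp_unroll (tau := 1) (J := fun t M' nc' o' =>
      [/\ Inv (hits i.+1) (found i) (fun=> 0) M', M' 10 = i, nc' = nc /\ o' = o &
         M' (addr r 3 s) = i /\
         forall t', t' < t -> M' (addr r (4 + t') s) = nth 0 (map val e) t'])).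
      split=> //; first by apply: inv_event => //; lia.
      by split=> //; rewrite /upd eqxx.
    move=> t M' nc' o' tr [hM' M'10 [-> ->] [e3 e4]].
    have te : t < size e by exact: leq_trans tr e_size.
    apply: wp_assign; rewrite ?evE ?(i9 hM') -?/s.
    - by apply: event_cells => //; lia.
    - by rewrite nth_val //; have := ltn_ord (nth v0 e t); peak_lia.
    split=> //.
    - by apply: inv_event => //; lia.
    - split; first by rewrite /upd addr_eq //; lia.
      move=> t'; rewrite ltnS leq_eqVlt => /predU1P[->|t't].
        by rewrite /upd eqxx.
      rewrite /upd addr_eq; try lia.
      by rewrite eqn_add2l (ltn_eqF t't) e4.
  move=> M' nc' o' [hM' M'10 [-> ->] [e3 e4]].
  apply: wp_cons; apply: wp_put; rewrite ?small // !evE (i9 hM') -/s addn1.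
    by peak_lia.
  apply: wp_nil; split=> //; rewrite foundS hk.
  apply: inv_push => // t tr; rewrite e4 // map_take nth_take //.
lia.
Qed.

Lemma read_wp M nc o :
  Inv (fun j => load r (X j) es) (events r D X es) (fun=> 0) M ->
  wp (map val e) (read r) M nc o (l * (10 * r + 41) + 10) (fun M' nc' o' =>
    [/\ Inv (fun j => load r (X j) es') (events r D X es') (fun=> 0) M', nc' = nc & o' = o]).
Proof.
move=> hM; have hl := l_le_2l.
eapply wp_tau.
  apply: wp_cons; apply: wp_put; rewrite ?evE ?small //; try exact: tiny.
  apply: wp_cons; apply: (wp_while (n := l) (tau := 10 * r + 40)
     (I := fun i => live i nc o)).
    split=> //; apply: (inv_ext (inv_put _ hM _)) => // [j v|].
      by rewrite /hits ltn0 addn0.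
    by rewrite /found take0 cats0.
  move=> i M' nc' o' ile [hM' M'10 -> ->].
  rewrite evE b2n !evE M'10 (c5 (ic hM')); case: ltnP => hi; last first.
    have il : i = l by lia.
    apply: wp_nil; split=> //; apply: (inv_ext hM') => // [j v|].
      by rewrite /hits load_rcons il ltn_ord.
    by rewrite il found_end.
  split=> //; pose j := Ordinal hi.
  eapply wp_tau.
    apply: wp_cons; apply: (wp_conseq (Q := fun M' nc' o' =>
      [/\ Inv (hits i.+1) (found i.+1) (fun=> 0) M', M' 10 = i, nc' = nc & o' = o])).
      apply: (wp_if (tau := 10 * r + 30)); rewrite ev_all.
      have -> : all (fun t => ev M' (map val e)
        (eEq (Cell (cell2 r 0 (vert t) (vr 10))) (Cell (cell2 r 0 (vert 0) (vr 10)))) != 0)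
          (iota 0 r) = clash r (X j) e.
        rewrite clashE //; apply: all_iota => // t tr.
        have te : t < size e by exact: leq_trans tr e_size.
        have e0 : 0 < size e by exact: leq_ltn_trans te.
        rewrite !evE b2n !nth_val // (c5 (ic hM')) M'10.
        by rewrite (iX hM' _ j) (iX hM' _ j).
      case cl : (clash r (X j) e); last first.
        apply: (wp_tau (tau := 1)); last by lia.
        apply: wp_skip; split=> //; rewrite foundS /kept cl.
        apply: (inv_ext hM') => // j' v; rewrite /hits ltnS (leq_eqVlt j').
        case: (eqVneq (val j') i) => //= ji.
        have -> : j' = j by apply: val_inj; rewrite /= ji.
        by rewrite cl andbF.
      eapply wp_tau.
        apply: wp_cons; apply: wp_conseq; first (have hbump := bump_wp nc o cl hM' M'10; exact hbump).
        move=> M2 nc2 o2 [hM2 M210 -> ->].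
        apply: wp_cons; apply: (wp_conseq (Q := fun M' nc' o' =>
          [/\ Inv (hits i.+1) (found i.+1) (fun=> 0) M', M' 10 = i, nc' = nc & o' = o])).
          apply: (wp_if (tau := 2 * r + 10)); rewrite ev_all.
          have -> : all (fun t => ev M2 (map val e)
            (eLeq (Cell (cell2 r 1 (vert t) (vr 10))) (vr 8)) != 0) (iota 0 r)
              = kept r D X es' e j.
            rewrite /kept cl; apply: all_iota => // t tr.
            have te : t < size e by exact: leq_trans tr e_size.
            rewrite !evE b2n nth_val // (c5 (ic hM2)) M210 (c8 (ic hM2)).
            by rewrite (iL hM2 _ j) (hits_now j : hits i.+1 j =1 _) /crowded -leqNgt.
          case hk : (kept r D X es' e j); first exact: store_wp.
          apply: (wp_tau (tau := 1)); last by lia.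
          by apply: wp_skip; split=> //; rewrite foundS hk.
        by move=> M3 nc3 o3 h3; apply: wp_nil.
      lia.
    move=> M2 nc2 o2 [hM2 M210 -> ->].
    apply: wp_cons; apply: wp_put; rewrite ?small // !evE M210.
      by peak_lia.
    apply: wp_nil; split=> //; last by rewrite /upd addn1.
    exact: inv_put.
  lia.
lia.
Qed.
End Read.

Notation coloring := {ffun 'I_n -> option 'I_l}.
Definition code_of (o : option 'I_l) : nat := if o is Some j then j.+1 else 0.

Lemma code_of_eq o j : (code_of o == j.+1) = (o == Some j).
Proof.
by case: o => [i|//] /=; rewrite eqSS; apply/eqP/eqP => [/val_inj -> //|[->]].
Qed.

Definition colored (x : coloring) v := code_of (x v).

Lemma find_blank_wp ld evs col M nc o : Inv ld evs col M ->
  wp [::] (find_blank r) M nc o (n * 2 + 10) (fun M' nc' o' =>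
    [/\ nc' = nc, o' = o, forall x, x != 14 -> M' x = M x,
        M' 14 <= n /\ (forall w : 'I_n, w < M' 14 -> 0 < col w) &
        forall v : 'I_n, val v = M' 14 -> col v = 0]).
Proof.
move=> hM; eapply wp_tau.
  apply: wp_cons; apply: wp_put; rewrite ?evE ?small //; try exact: tiny.
  apply: wp_cons; apply: (wp_while (n := n) (tau := 1) (I := fun i M' nc' o' =>
    [/\ nc' = nc, o' = o, forall x, x != 14 -> M' x = M x, M' 14 = i &
        forall w : 'I_n, w < i -> 0 < col w])).
    by split=> // x /negbTE h; rewrite /upd h.
  move=> i M' nc' o' ile [-> -> fr M'14 hi].
  have frA t x : M' (addr r t x) = M (addr r t x).
    by apply: fr; rewrite addr_scalar.
  rewrite ev_mul !ev_lt b2n2 ev_const.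
  rewrite [ev M' _ (arr _ _ _)]ev_cell !evE M'14 fr // (c0 (ic hM)) frA.
  case: ltnP => iN /=; last first.
    apply: wp_nil; split=> //; rewrite M'14 //.
    by move=> v vi; move: (ltn_ord v); rewrite -[val v]/(nat_of_ord v) in vi; lia.
  rewrite -[i]/(val (Ordinal iN)) (iC hM); case: posnP => ci.
    apply: wp_nil; split=> //; rewrite M'14 //.
    by move=> v vi; rewrite -ci; congr col; exact: val_inj.
  split=> //; apply: wp_put; rewrite ?small // !evE M'14.
    by peak_lia.
  split=> //; first by move=> x h; rewrite /upd (negbTE h) fr.
    by rewrite /upd addn1.
  move=> w; rewrite ltnS leq_eqVlt => /predU1P[wi|/hi //].
  by have -> : w = Ordinal iN by exact: val_inj.
lia.
Qed.

Lemma mend_wp ld evs (x : coloring) M nc o :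
  (forall E, E \in evs -> uniq E.1 && (size E.1 == r)) ->
  size evs <= n * (l * D) -> Inv ld evs (colored x) M ->
  wp [::] (mend r) M nc o (n * (l * D) * (2 * r + 20) + 10) (fun M' nc' o' =>
    [/\ nc' = nc, o' = o, M' 15 = M 15 & Inv ld evs (colored (repair evs x)) M']).
Proof.
move=> evs_ok evs_size hM.
have nlD : n * (l * D) <= n * l * D.+1 by rewrite mulnA leq_mul2l leqnSn orbT.
pose fix_event (z : coloring) (E : event) := if violated z E then erase z E.1 else z.
pose part i := foldl fix_event x (take i evs).
apply: (wp_tau (tau := (1 + ((size evs * (2 * r + 19).+1).+1 + 1).+1).+1)); last first.
  have : size evs * (2 * r + 20) <= n * (l * D) * (2 * r + 20) by rewrite leq_mul2r evs_size orbT.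
  by rewrite -(addnS _ 19); move: (_ * _) (_ * _) => y z; lia.
apply: wp_cons; apply: wp_put; rewrite ?evE ?small //; try exact: tiny.
apply: wp_cons; apply: (wp_while (n := size evs) (I := fun i M' nc' o' =>
    [/\ nc' = nc, o' = o, M' 15 = M 15 & Inv ld evs (colored (part i)) M' /\ M' 10 = i])).
  split=> //; split=> //; rewrite /part take0; exact: inv_put.
move=> i M' nc' o' ile [-> -> M'15 [hM' M'10]].
rewrite evE b2n !evE M'10 (i9 hM'); case: ltnP => hi; last first.
  apply: wp_nil; split=> //; move: hM'; rewrite /part take_oversize //.
split=> //.
pose E0 : event := ([::], Ordinal l_gt0); pose E := nth E0 evs i.
have /andP[Eu /eqP Es] : uniq E.1 && (size E.1 == r) by apply/evs_ok/mem_nth.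
have [e3 e4] := iE hM' E0 hi; rewrite -/E in e3 e4.
have e4' t : t < r -> M' (addr r (4 + t) i) = nth v0 E.1 t.
  by move=> tr; rewrite e4 // nth_val // Es.
have partS : part i.+1 = fix_event (part i) E.
  by rewrite /part (take_nth E0) // foldl_rcons.
eapply wp_tau.
  apply: wp_cons; apply: (wp_conseq (Q := fun M' nc' o' =>
      [/\ nc' = nc, o' = o, M' 15 = M 15 & Inv ld evs (colored (part i.+1)) M' /\ M' 10 = i])).
    apply: (wp_if (tau := (r * 2).+1)); rewrite ev_all.
    have -> : all (fun t => ev M' [::] (eEq (arr r 2 (arr r (4 + t) (vr 10)))
                           (eAdd (arr r 3 (vr 10)) (Const 1))) != 0) (iota 0 r)
        = violated (part i) E.
      rewrite /violated -[in RHS](take_oversize (_ : size E.1 <= r)) ?Es //.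
      apply: all_iota; rewrite ?Es // => t tr.
      rewrite ev_eq b2n ev_add ev_const !ev_cell !ev_adr ev_cell ev_adr ev_vr M'10.
      by rewrite e4' // e3 (iC hM') addn1 code_of_eq.
    rewrite partS /fix_event; case vE: (violated _ _); last first.
      by apply: (wp_tau (tau := 1)) => //; exact: wp_skip.
    apply: (wp_conseq (Q := fun M' nc' o' =>
      [/\ nc' = nc, o' = o, M' 15 = M 15 &
        Inv ld evs (fun v => if v \in take r E.1 then 0 else colored (part i) v) M' /\ M' 10 = i])).
      apply: (wp_unroll (tau := 1) (J := fun t M' nc' o' =>
        [/\ nc' = nc, o' = o, M' 15 = M 15 &
        Inv ld evs (fun v => if v \in take t E.1 then 0 else colored (part i) v) M' /\ M' 10 = i])).
        by split=> //; split=> //; apply: (inv_ext hM') => // v; rewrite take0.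
      move=> t M2 nc2 o2 tr [-> -> M215 [hM2 M210]].
      have e4t : M2 (addr r (4 + t) i) = nth v0 E.1 t.
        have [_ h] := iE hM2 E0 hi; rewrite h // -/E nth_val // Es //.
      apply: wp_assign; rewrite ?ev_adr ?ev_cell ?ev_adr ?ev_vr ?M210 ?e4t ?ev_const //.
        exact: vertex_cells.
      split=> //; split=> //; apply: (inv_ext (inv_col _ _ hM2)) => // v.
      by rewrite mem_take_nth ?Es //; case: eqVneq.
    move=> M2 nc2 o2 [-> -> M215 [hM2 M210]]; split=> //; split=> //.
    apply: (inv_ext hM2) => // v; rewrite take_oversize ?Es //.
    by rewrite /colored /erase ffunE; case: ifP.
  move=> M2 nc2 o2 [-> -> M215 [hM2 M210]].
  apply: wp_cons; apply: wp_put; rewrite ?small // !evE M210.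
    by peak_lia.
  apply: wp_nil; split=> //; split; last by rewrite /upd addn1.
  exact: inv_put.
lia.
Qed.

Section Postprocessing.
Variable es : seq (seq 'I_n).
Hypothesis es_ok : forall e, e \in es -> uniq e && (r <= size e).
Hypothesis es_degree : forall v, count (fun e => v \in e) es <= Delta.
Let ld j := load r (X j) es.
Let evs := events r D X es.
Let ban v j := crowded r D X es v j.

Let evs_ok E : E \in evs -> uniq E.1 && (size E.1 == r).
Proof. exact: (events_ok es_ok). Qed.

Let evs_size : size evs <= n * (l * D).
Proof. by rewrite -[n in leqRHS](card_ord n); apply: size_events => //; exact: ltnW. Qed.

Let T1 := n * 2 + 10 + (8 * a + 20) + n * (l * D) * (2 * r + 20) + 30.

Lemma attempt_wp x M nc o c : Inv ld evs (colored x) M -> val c = digit coin nc a ->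
  M 15 < 10 * n ->
  wp [::] (attempt_cmd r) M nc o T1 (fun M' nc' o' =>
    [/\ Inv ld evs (colored (attempt ban evs (@least n) x c)) M', M' 15 = (M 15).+1,
        nc' = nc + a & o' = o]).
Proof.
move=> hM cE M15; eapply wp_tau.
  apply: wp_cons; apply: wp_conseq; first exact (find_blank_wp nc o hM).
  move=> M1 nc1 o1 [-> -> fr1 [M1n h1] h1'].
  apply: wp_cons; apply: wp_conseq.
    apply: (@draw_wp A coin cells peak [::] 5 a M1 nc o) => //.
      by rewrite fr1 // (c5 (ic hM)).
    by have := l_le_q => ?; apply: leq_trans l_le_q _; peak_lia.
  move=> M2 nc2 o2 [-> -> M211 fr2].
  have hM2 : Inv ld evs (colored x) M2.
    apply: (inv_frame hM) => y hy; rewrite fr2; last first.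
      by move: hy; rewrite !inE /scratch; lia.
    by apply: fr1; move: hy; rewrite /scratch; lia.
  have M214 : M2 14 = M1 14 by exact: fr2.
  have M215 : M2 15 = M 15 by rewrite fr2 // fr1.
  apply: wp_cons; apply: (wp_conseq (Q := fun M' nc' o' =>
    [/\ Inv ld evs (colored (place ban (@least n) x c)) M', M' 15 = M 15,
        nc' = nc + a & o' = o])).
    apply: (wp_if (tau := 1)).
    rewrite ev_mul ev_lt ev_leq b2n2 !ev_vr ev_cell ev_cell2 !ev_vr.
    rewrite (c0 (ic hM2)) (c5 (ic hM2)) (c8 (ic hM2)) M211 M214 -cE.
    case: ltnP => vn /=; last first.
      apply: wp_skip; split=> //.
      suff -> : place ban (@least n) x c = x by [].
      rewrite /place; case lE: least => [v|] //.
      have := least_some lE; rewrite inE => /eqP xv.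
      have := h1 v (leq_trans (ltn_ord v) vn).
      by rewrite /colored xv.
    pose v := Ordinal vn; rewrite -[M1 14]/(val v) (iL hM2).
    have lE : least (blank x) = Some v.
      apply: leastP.
        by rewrite inE; have := h1' v erefl; rewrite /colored; case: (x v).
      move=> w; rewrite inE => /eqP xw; rewrite leqNgt; apply/negP => wv.
      by have := h1 w wv; rewrite /colored xw.
    rewrite /place lE /ban /crowded -/(ld c) leqNgt; case: (D < ld c v) => /=; last first.
      apply: wp_assign.
      - rewrite ev_adr ev_vr M214 -[M1 14]/(val v); exact: vertex_cells.
      - rewrite ev_add ev_vr ev_const M211 -cE addn1.
        by have hc : val c < l := ltn_ord c; have hl := l_le_2l; peak_lia.
      rewrite ev_adr ev_add !ev_vr ev_const M211 M214 -cE -[M1 14]/(val v) addn1.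
      split=> //; apply: (inv_ext (inv_col _ _ hM2)) => // w.
      by rewrite /colored ffunE; case: eqVneq.
    by apply: wp_skip.
  move=> M3 nc3 o3 [hM3 M315 -> ->].
  apply: wp_cons; apply: wp_conseq; first exact (mend_wp (nc + a) o evs_ok evs_size hM3).
  move=> M4 nc4 o4 [-> -> M415 hM4].
  apply: wp_cons; apply: wp_put; rewrite ?small // !evE M415 M315.
    by peak_lia.
  apply: wp_nil; split=> //; last by rewrite /upd /= addn1.
  exact: inv_put.
rewrite /T1; lia.
Qed.

Let x_end := @final n r Delta es X (@coin_choices n r Delta coin).

Lemma tries_wp M o : Inv ld evs (fun=> 0) M ->
  wp [::] (tries r) M (choice_start n r Delta) o (10 * n * T1.+1 + 10) (fun M' nc' o' =>
    [/\ Inv ld evs (colored x_end) M' & o' = o]).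
Proof.
move=> hM; eapply wp_tau.
  apply: wp_cons; apply: wp_put; rewrite ?evE ?small //; try exact: tiny.
  apply: wp_cons; apply: (wp_while (n := 10 * n) (tau := T1) (I := fun i M' nc' o' =>
    [/\ nc' = choice_start n r Delta + i * a, o' = o, M' 15 = i &
        Inv ld evs (colored (search ban evs (@least n) [ffun=> None]
          [seq @coin_choice n r Delta coin t | t <- iota 0 i])) M'])).
    split; rewrite ?addn0 //; apply: (inv_ext (inv_put _ hM _)) => // v.
    by rewrite /colored ffunE.
  move=> i M' nc' o' ile [-> -> M'15 hM'].
  rewrite ev_lt b2n ev_mul !ev_vr ev_const M'15 (c0 (ic hM')).
  case: ltnP => hi; last first.
    by apply: wp_nil; split=> //; move: hM'; have -> : i = 10 * n by lia.
  split=> //; apply: wp_conseq.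
    apply: (@attempt_wp _ _ _ _ (@coin_choice n r Delta coin i) hM') => //.
    by rewrite M'15.
  move=> M2 nc2 o2 [hM2 M215 -> ->]; split=> //.
  - by rewrite mulSn; lia.
  - by rewrite M215 M'15.
  move: hM2; rewrite -[i.+1]addn1 iotaD map_cat /search foldl_cat //.
lia.
Qed.

Lemma report_wp M nc o : Inv ld evs (colored x_end) M ->
  wp [::] (report r) M nc o (n * 10 + 10) (fun M' nc' o' =>
    o' = o ++ [seq color X x_end v | v <- enum 'I_n]).
Proof.
move=> hM; eapply wp_tau.
  apply: wp_cons; apply: wp_put; rewrite ?evE ?small //; try exact: tiny.
  apply: wp_cons; apply: (wp_while (n := n) (tau := 8) (I := fun i M' nc' o' =>
    [/\ Inv ld evs (colored x_end) M', M' 14 = i &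
       o' = o ++ [seq color X x_end v | v <- take i (enum 'I_n)]])).
    by split; rewrite ?take0 ?cats0 //; exact: inv_put.
  move=> i M' nc' o' ile [hM' M'14 ->].
  rewrite ev_lt b2n !ev_vr M'14 (c0 (ic hM')); case: ltnP => hi; last first.
    by apply: wp_nil; rewrite take_oversize // size_enum_ord.
  split=> //; pose v := Ordinal hi; eapply wp_tau.
    apply: wp_cons; apply: wp_emit.
    apply: wp_cons; apply: wp_put; rewrite ?small //.
      by rewrite ev_add ev_vr ev_const M'14; peak_lia.
    apply: wp_nil; split=> //.
    - exact: inv_put.
    - by rewrite ev_add ev_vr ev_const M'14 /upd addn1.
    rewrite (take_nth v) ?size_enum_ord // map_rcons (nth_ord_enum v v) -rcons_cat.
    congr rcons; rewrite ev_add ev_mul ev_sub ev_cell ev_cell2 ev_sub !ev_cell !ev_adr !ev_vr.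
    rewrite ev_const M'14 -[i]/(val v) (iC hM') (c7 (ic hM')) (c5 (ic hM')).
    rewrite /color /colored; case: (x_end v) => [j|] /=.
      by rewrite subn1 /= (iX hM' v j).
    by rewrite sub0n mul0n (iX hM' v (Ordinal l_gt0)).
  by [].
lia.
Qed.

End Postprocessing.
End Correctness.

(** * Space used by expressions and configurations *)

Section Cost.
Variables (A : algorithm) (coin : nat -> bool) (N Bd k : nat).
(** If all cells are at most [Bd], the value of [e] is at most [Bd ^ expo e]: an
    exponent that depends on the program only. *)
Fixpoint expo (e : expr) : nat :=
  match e with
  | Const c => c
  | Cell _ | EdgeSize | EdgeVertex _ => 1
  | BinOp _ e1 e2 => (expo e1 + expo e2).+1
  end.

Fixpoint ecost (e : expr) : nat :=
  (expo e).+1 +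
  match e with
  | Const _ | EdgeSize => 0
  | Cell a => ecost a
  | EdgeVertex i => ecost i
  | BinOp _ e1 e2 => ecost e1 + ecost e2
  end.

Fixpoint ccost (c : cmd) : nat :=
  match c with
  | Skip => 0
  | Assign a e => ecost a + ecost e
  | Flip a => ecost a
  | Emit e => ecost e
  | Then c1 c2 => ccost c1 + ccost c2
  | If e c1 c2 => ecost e + ccost c1 + ccost c2
  | While e c1 => ecost e + ccost c1
  end.

Definition acost := ccost (on_start A) + ccost (on_edge A) + ccost (on_end A).

Definition edge_fits (e : seq nat) :=
  [&& all (fun x => x <= Bd) e, size e <= k & size e <= Bd].

Definition fits (c : config) :=
  [&& all (fun i => ccost i <= acost) (code c), edge_fits (edge c) &
      all edge_fits (future c)].

Lemma step_fits c : fits c -> fits (step A coin c).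
Proof.
case: c => [cd p fut ed m nc o] /and3P[/= hc he hf].
case: cd hc => [_|i cd /= /andP[hi hc]].
  rewrite /step /=; case: p; first by apply/and3P.
  case: fut hf => [_|e es /= /andP[? ?]]; apply/and3P; split=> //=;
  by rewrite /acost ?andbT; lia.
rewrite /step /=; case: i hi => /= *; apply/and3P; split => //=.
- by rewrite hc andbT; apply/andP; split; lia.
- by rewrite hc andbT; case: ifP => _; lia.
- by case: ifP => //= _; rewrite hc andbT; apply/andP; split; lia.
Qed.

Lemma run_fits init s t : all edge_fits s -> fits (run A coin init s t).
Proof.
move=> hs; elim: t => [|t IH]; last by rewrite /run iterS; exact: step_fits.
by apply/and3P; split=> //=; rewrite /acost andbT; lia.
Qed.

Hypothesis Bd_ge2 : 1 < Bd.

Lemma bits_le x y : x <= y -> bits x <= bits y.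
Proof. by move=> h; rewrite /bits ltnS leq_trunc_log. Qed.

Lemma bits_exp x p : x <= Bd ^ p -> bits x <= p.+1 * bits Bd.
Proof.
move=> h; have h2 : Bd <= 2 ^ bits Bd by rewrite ltnW // trunc_log_ltn.
have h3 : x <= 2 ^ (bits Bd * p).
  by apply: leq_trans h _; rewrite expnM; case: p => // p; rewrite leq_exp2r.
apply: leq_trans (bits_le h3) _.
by rewrite {1}/bits trunc_expnK // mulSn mulnC -add1n leq_add2r.
Qed.

Section Eval.
Variables (m ed : seq nat).
Hypothesis m_le : all (fun x => x <= Bd) m.
Hypothesis ed_le : all (fun x => x <= Bd) ed.
Hypothesis ed_size : size ed <= Bd.

Lemma nth_le s i : all (fun x => x <= Bd) s -> nth 0 s i <= Bd.
Proof.
move=> /(all_nthP 0) h; case: (ltnP i (size s)) => [/h //|?].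
by rewrite nth_default.
Qed.

Lemma eval_le e : eval m ed e <= Bd ^ expo e.
Proof.
have Bd0 : 0 < Bd by lia.
elim: e => /= [c|a _||i _|o e1 h1 e2 h2]; rewrite ?expn1 ?nth_le //.
  by apply: leq_trans (ltnW (ltn_expl c (isT : 1 < 2))) _; case: c => // c; rewrite leq_exp2r.
have h1' : Bd ^ expo e1 <= Bd ^ (expo e1 + expo e2).+1 by rewrite leq_pexp2l //; lia.
have hb (b : bool) : b <= Bd ^ (expo e1 + expo e2).+1.
  by apply: leq_trans (leq_b1 b) _; rewrite expn_gt0 Bd0.
case: o => /=; rewrite ?hb //.
- have g1 : Bd ^ expo e1 <= Bd ^ (expo e1 + expo e2) by rewrite leq_pexp2l ?leq_addr.
  have g2 : Bd ^ expo e2 <= Bd ^ (expo e1 + expo e2) by rewrite leq_pexp2l ?leq_addl.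
  rewrite expnS; apply: leq_trans (_ : 2 * Bd ^ (expo e1 + expo e2) <= _); first by lia.
  by rewrite leq_mul2r Bd_ge2 orbT.
- exact: leq_trans (leq_subr _ _) (leq_trans h1 h1').
- apply: leq_trans (leq_mul h1 h2) _; rewrite -expnD leq_pexp2l //.
- exact: leq_trans (leq_div _ _) (leq_trans h1 h1').
- exact: leq_trans (leq_mod _ _) (leq_trans h1 h1').
Qed.

Lemma eval_bits_le e : eval_bits m ed e <= ecost e * bits Bd.
Proof.
elim: e => [c|a h||i h|o e1 h1 e2 h2] /=; rewrite mulnDl.
- exact: leq_add (bits_exp (eval_le (Const c))) _.
- exact: leq_add (bits_exp (eval_le (Cell a))) h.
- exact: leq_add (bits_exp (eval_le EdgeSize)) _.
- exact: leq_add (bits_exp (eval_le (EdgeVertex i))) h.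
- apply: leq_add (bits_exp (eval_le (BinOp o e1 e2))) _.
  by rewrite mulnDl leq_add.
Qed.

Lemma cmd_bits_le c : cmd_bits m ed c <= ccost c * bits Bd.
Proof.
case: c => //= *; rewrite ?mulnDl ?leq_add ?eval_bits_le //.
  by rewrite -addnA (leq_trans (eval_bits_le _)) // leq_addr.
by rewrite (leq_trans (eval_bits_le _)) // leq_addr.
Qed.
End Eval.

Lemma scratch_le c : fits c -> safe N Bd (memory c) -> scratch_bits c <= acost * bits Bd.
Proof.
case: c => [cd p fut ed m nc o] /and3P[/= hc he _] /andP[_ hm].
rewrite /scratch_bits /=; case: cd hc => //= i cd /andP[hi _].
have /and3P[h1 _ h2] := he.
by apply: leq_trans (cmd_bits_le hm h1 h2 i) _; rewrite leq_mul2r hi orbT.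
Qed.

Lemma total_bits_le s : all (fun x => x <= Bd) s -> total_bits s <= size s * bits Bd.
Proof.
rewrite /total_bits; elim: s => [|x s IH] /=; first by rewrite big_nil.
by move=> /andP[hx /IH h]; rewrite big_cons mulSn leq_add // bits_le.
Qed.

Lemma space_le c : fits c -> safe N Bd (memory c) ->
  space_used c <= (N + k + acost) * bits Bd.
Proof.
move=> hc hs; rewrite /space_used 2!mulnDl.
have /and3P[_ /and3P[h1 h2 _] _] := hc; have /andP[h3 h4] := hs.
apply: leq_add; last exact: scratch_le.
apply: leq_add.
  by apply: leq_trans (total_bits_le h4) _; rewrite leq_mul2r h3 orbT.
by apply: leq_trans (total_bits_le h1) _; rewrite leq_mul2r h2 orbT.
Qed.
End Cost.

(** * Runs of the program on a stream *)

Section Stream.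
Variables (n r k Delta : nat) (coin : nat -> bool).
Hypothesis r_ge2 : 1 < r.
Hypothesis n_gt1 : 1 < n.
Variable es : seq (seq 'I_n).
Hypothesis es_ok : forall e, e \in es -> [&& uniq e, r <= size e & size e <= k].
Hypothesis es_degree : forall v, count (fun e => v \in e) es <= Delta.
Let X := @coin_table n r Delta coin.
Let N := cells n r Delta.
Let Bd := peak n r k Delta.
Let run_at := stream_run (coloring_algorithm r) r k Delta es coin.

Definition post_steps :=
  let l := nlist n r Delta in
  10 * n * (n * 2 + 10 + (8 * aexp n r Delta + 20)
            + n * (l * cap n r Delta) * (2 * r + 20) + 30).+1 + 10
  + (n * 10 + 10) + 1.

Lemma es_ok' e : e \in es -> uniq e && (r <= size e).
Proof. by move=> /es_ok /and3P[-> ->]. Qed.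

Lemma peak_gt1 : 1 < Bd.
Proof. by rewrite /Bd /peak; lia. Qed.

Lemma stream_fits t :
  fits (coloring_algorithm r) Bd k (run_at t).
Proof.
apply: run_fits; apply/allP => _ /mapP[e ein ->].
have /and3P[_ h1 h2] := es_ok ein; rewrite /edge_fits size_map.
have [_ _ _ _ hp] := peakP k Delta r_ge2 n_gt1.
apply/and3P; split=> //.
  apply/allP => _ /mapP[v _ ->]; apply: leq_trans (ltnW (ltn_ord v)) _.
  by rewrite /Bd; lia.
by apply: leq_trans h2 _; rewrite /Bd /peak; lia.
Qed.

Lemma stream_run_spec :
  (forall t, safe N Bd (memory (run_at t))) /\
  exists t0 t1,
    [/\ forall t, t < t0 -> ~~ post (run_at t), t1 <= post_steps,
        halted (run_at (t0 + t1)) &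
        output (run_at (t0 + t1)) =
          [seq color X (@final n r Delta es X (@coin_choices n r Delta coin)) v
          | v <- enum 'I_n]].
Proof.
pose raw := map (map (@nat_of_ord n)).
pose P (raws : seq (seq nat)) (M : store) (nc : nat) (o : seq nat) :=
  exists2 es1, raws = raw es1 /\ exists es2, es = es1 ++ es2 &
  [/\ @Inv coin n r Delta (fun j => load r (X j) es1)
       (events r (cap n r Delta) X es1) (fun=> 0) M,
      nc = choice_start n r Delta & o = [::]].
have rawI : injective raw by apply: inj_map; apply: inj_map; exact: val_inj.
pose l := nlist n r Delta.
pose taus := (2 * mexp r Delta + 10 * aexp n r Delta + 40 +
  ((n * l) * (8 * bexp n r Delta + 20 + 10).+1).+1).+1 + (l * (10 * r + 41) + 10).
pose Q (M : store) (nc : nat) (o : seq nat) :=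
  o = [seq color X (@final n r Delta es X (@coin_choices n r Delta coin)) v
          | v <- enum 'I_n].
have := @run_wp (coloring_algorithm r) coin N Bd [:: n; r; k; Delta] (raw es)
  taus post_steps P Q.
case.
- apply/andP; split=> //=; have [_ _ _ _ hp] := peakP k Delta r_ge2 n_gt1.
  by rewrite /Bd; do !(apply/andP; split => //); rewrite ?leq_addl //; rewrite /peak; lia.
- apply: (wp_tau (tau := (2 * mexp r Delta + 10 * aexp n r Delta + 40 +
    ((n * l) * (8 * bexp n r Delta + 20 + 10).+1).+1).+1)); last by rewrite /taus leq_addr.
  apply: wp_then; apply: wp_conseq.
    apply: (@sizes_wp _ coin n r k Delta r_ge2 n_gt1 _ 0 [::]) => //.
    by case=> [|[|[|[|x]]]] //= _; rewrite nth_nil.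
  move=> M nc o [-> -> cM M9 [M10 Mz]]; apply: wp_conseq.
    exact (@fill_wp _ coin n r k Delta r_ge2 n_gt1 _ 0 [::] cM M9 M10 Mz erefl).
  move=> M' nc' o' [hM -> ->]; exists [::]; last by split.
  by split=> //; exists es.
- move=> raws _e raws' rE M nc o [es1 [rawE [es2 esE]] [hM -> ->]].
  case: es2 esE rE => [|e es2] esE rE.
    move/(congr1 size): rE; rewrite esE cats0 rawE size_cat /= /raw !size_map; lia.
  have [E1 E2] : _e = map val e /\ raws' = raw es2.
    move: rE; rewrite esE rawE /raw map_cat /= => /(congr1 (drop (size es1))).
    by rewrite !drop_size_cat ?size_map // => -[<- <-].
  have ein : e \in es by rewrite esE mem_cat mem_head orbT.
  have /and3P[ue re _] := es_ok ein.
  have sub v : count (fun e => v \in e) (rcons es1 e) <= Delta.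
    apply: leq_trans (es_degree v); rewrite esE -cat_rcons.
    by rewrite [leqRHS]count_cat leq_addr.
  have ok1 e' : e' \in rcons es1 e -> uniq e' && (r <= size e').
    move=> h; apply: es_ok'; rewrite esE -cat_rcons mem_cat h //.
  rewrite E1; apply: (wp_tau (tau := l * (10 * r + 41) + 10)); last by rewrite leq_addl.
  apply: wp_conseq.
    apply: (@read_wp _ coin n r k Delta r_ge2 n_gt1 _ _ ue re _ _ _ _ _ hM).
    + move=> j v; apply: leq_trans (sub v); apply: sub_count => e' /andP[_].
      exact: mem_take.
    + rewrite -[X in _ <= X * _](card_ord n); apply: size_events ok1.
      exact: ltnW.
  move=> M' nc' o' [hM' -> ->]; exists (rcons es1 e); last by split.
  split; first by rewrite rawE /raw map_rcons.
  by exists es2; rewrite cat_rcons.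
- move=> M nc o [es1 [/rawI <- _] [hM -> ->]].
  rewrite /post_steps addn1; apply: wp_then; apply: wp_conseq.
    exact (@tries_wp _ coin n r k Delta r_ge2 n_gt1 _ es_ok' _ [::] hM).
  move=> M' nc' o' [hM' ->]; apply: wp_conseq.
    exact (@report_wp _ coin n r k Delta r_ge2 n_gt1 _ es_ok' _ nc' [::] hM').
  by move=> M2 nc2 o2 ->.
move=> hsafe [t0 [t1 [h1 h2 h3 [M [nc hQ]]]]]; split=> //.
by exists t0, t1.
Qed.
End Stream.

From mathcomp Require Import all_order all_algebra.
From mathcomp Require Import all_classical all_reals all_analysis.
From mathcomp Require Import measurable_realfun.
From mathcomp Require Import ring lra.

Import Order.TTheory GRing.Theory Num.Theory.
Local Open Scope ring_scope.

(** * Fair coins, expectation and postprocessing time *)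

Section FairCoins.
Context {d : measure_display} {T : measurableType d} {R : realType}.
Variables (P : probability T R) (coin : nat -> T -> bool).
Hypothesis fair : fair_coins P coin.
Local Open Scope classical_set_scope.

(** An event that depends on the first [m] coins is a disjoint union of cylinders. *)
Lemma fair_coins_event m (G : (nat -> bool) -> bool) :
  (forall c c', (forall i, (i < m)%N -> c i = c' i) -> G c = G c') ->
  measurable [set w | G (coin^~ w)] /\
  P [set w | G (coin^~ w)] =
    (#|[pred t : m.-tuple bool | G (nth false t)]|%:R * 2%:R^-1 ^+ m)%:E.
Proof.
case: fair => mcoin pcoin local.
pose cyl (b : m.-tuple bool) := [set w | forall i : 'I_m, coin i w = tnth b i].
have mcyl b : measurable (cyl b).
  have -> : cyl b = \bigcap_(i in [set: 'I_m]) [set w | coin i w = tnth b i].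
    by apply/seteqP; split=> w /= h i; [move=> _|]; exact: h.
  apply: fin_bigcap_measurable; first exact: finite_finset.
  move=> i _; case: (tnth b i); first exact: mcoin.
  have -> : [set w | coin i w = false] = ~` [set w | coin i w].
    by apply/seteqP; split=> w /=; [move=> ->|move/negP/negbTE].
  exact/measurableC/mcoin.
pose D := [set b : m.-tuple bool | G (nth false b)].
have SE : [set w | G (coin^~ w)] = \bigcup_(b in D) cyl b.
  apply/seteqP; split=> w /=.
    move=> Gw; exists [tuple coin i w | i < m]; last by move=> i; rewrite tnth_mktuple.
    rewrite /D /=; rewrite -(local (coin^~ w)) // => i im.
    by rewrite -[i]/(val (Ordinal im)) nth_mktuple.
  move=> [b Db bw]; rewrite (local _ (nth false b)) // => i im.
  by rewrite (bw (Ordinal im)) (tnth_nth false).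
have fD : finite_set D by exact: finite_finset.
split; first by rewrite SE; apply: fin_bigcup_measurable => // b _.
rewrite SE measure_fin_bigcup //; last first.
  move=> b b' _ _ [w [h h']]; apply: eq_from_tnth => i.
  by rewrite -h -h'.
rewrite (eq_fsbigr (fun=> (2%:R^-1 ^+ m)%:E)) => [|b _]; last exact: pcoin.
have -> : D = [set` enum [pred t : m.-tuple bool | G (nth false t)]].
  by apply/seteqP; split=> b /=; rewrite mem_enum.
rewrite -fsbig_seq ?enum_uniq // big_enum /= sumEFin; congr (_%:E).
by rewrite sumr_const mulr_natl.
Qed.

End FairCoins.

Section Integral.
Context {d : measure_display} {T : measurableType d} {R : realType}.
Variable P : probability T R.
Import HBNNSimple.
Local Open Scope ereal_scope.

(** The integral of a nonnegative function is the supremum of the integrals of the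
    simple functions below it, and these are below the constant [c]. *)
Lemma expectation_le_bound (f : T -> \bar R) (c : R) :
  (forall w, 0 <= f w) -> (forall w, f w <= c%:E) -> \int[P]_w f w <= c%:E.
Proof.
move=> f0 fc; rewrite ge0_integralTE //; apply/ge_ereal_sup => _ [h /= hf <-].
have hc w : (h w)%:E <= c%:E by exact: le_trans (hf w) (fc w).
have -> : sintegral P h = \int[P]_w (h w)%:E.
  by rewrite integral_nnsfun //; congr sintegral; apply/boolp.funext => w; rewrite patch_setT.
apply: le_trans (_ : \int[P]_w (cst c%:E) w <= _).
  apply: ge0_le_integral => //.
  - by move=> w _; rewrite lee_fin.
  - exact/measurable_EFinP.
rewrite integral_cst // [X in _ * X](_ : _ = 1) ?mule1 //; exact: probability_setT.
Qed.
End Integral.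

Lemma window_sum (t0 t1 K m : nat) :
  (\sum_(0 <= i < m) (if t0 <= i < t0 + t1 then K else 0)
     <= (minn m (t0 + t1) - t0) * K)%N.
Proof.
elim: m => [|m IH]; first by rewrite big_geq.
rewrite big_nat_recr //=; case: ifP => h.
  have -> : (minn m.+1 (t0 + t1) - t0 = (minn m (t0 + t1) - t0).+1)%N by lia.
  by rewrite mulSn addnC leq_add2l.
by rewrite addn0; apply: leq_trans IH _; rewrite leq_mul2r; lia.
Qed.

Section PostTime.
Variable R : realType.
Local Open Scope ereal_scope.

Lemma post_time_le (c : nat -> config) (t0 t1 K : nat) :
  (forall t, (t < t0)%N -> ~~ post (c t)) ->
  (forall t, (t0 + t1 <= t)%N -> halted (c t)) ->
  (forall t, (step_time (c t) <= K)%N) ->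
  0 <= post_time R c <= (t1 * K)%:R%:E.
Proof.
move=> h0 h1 hK; rewrite /post_time ifT; last first.
  by apply/asboolP; exists (t0 + t1)%N; exact: h1.
pose g t : nat := if post (c t) then step_time (c t) else 0%N.
have g0 i : 0 <= ((g i)%:R : R)%:E by rewrite lee_fin ler0n.
apply/andP; split; first by apply: nneseries_ge0 => i _ _; exact: g0.
apply: lime_le; first by apply: is_cvg_nneseries => i _ _; exact: g0.
apply: nearW => m /=; rewrite sumEFin lee_fin -natr_sum ler_nat.
have gb i : (g i <= (if (t0 <= i < t0 + t1)%N then K else 0))%N.
  rewrite /g; case: (ltnP i t0) => //= hi; first by rewrite (negbTE (h0 i hi)).
  case: (ltnP i (t0 + t1)) => /= hi2; first by case: ifP.
  by rewrite /step_time (h1 i hi2); case: ifP.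
apply: leq_trans (_ : (\sum_(0 <= i < m) (if t0 <= i < t0 + t1 then K else 0) <= _)%N).
  by apply: leq_sum => i _; exact: gb.
by apply: leq_trans (window_sum _ _ _ _) _; rewrite leq_mul2r; lia.
Qed.
End PostTime.

(** * Asymptotic bounds *)

(** As [2 <= n], constants too are at most powers of [n], so that every polynomial
    bound can be put in the form [n ^ p]. *)
Section Growth.
Local Open Scope nat_scope.
Variable n : nat.
Hypothesis n_gt1 : 1 < n.

Lemma pow_const c : c <= n ^ c.
Proof.
by apply: leq_trans (ltnW (ltn_expl c (isT : 1 < 2))) _; case: c => // c; rewrite leq_exp2r.
Qed.

Lemma pow_mul x y p q : x <= n ^ p -> y <= n ^ q -> x * y <= n ^ (p + q).
Proof. by move=> hx hy; rewrite expnD leq_mul. Qed.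

Lemma pow_add x y p q : x <= n ^ p -> y <= n ^ q -> x + y <= n ^ (p + q).+1.
Proof.
have n0 : 0 < n by lia.
move=> hx hy; have g1 : n ^ p <= n ^ (p + q) by rewrite leq_pexp2l ?leq_addr.
have g2 : n ^ q <= n ^ (p + q) by rewrite leq_pexp2l ?leq_addl.
rewrite expnS; apply: leq_trans (_ : 2 * n ^ (p + q) <= _); first by lia.
by rewrite leq_mul2r n_gt1 orbT.
Qed.

Lemma pow_succ x p : x <= n ^ p -> x.+1 <= n ^ (p + 1).+1.
Proof. by move=> hx; rewrite -addn1; apply: pow_add => //; apply: pow_const. Qed.

Lemma pow_exp x p j : x <= n ^ p -> x ^ j <= n ^ (p * j).
Proof. by move=> hx; rewrite expnM; case: j => // j; rewrite leq_exp2r. Qed.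

Lemma bits_pow : 2 ^ bits n <= n ^ 2.
Proof.
rewrite /bits expnS; have n0 : 0 < n by lia.
have := trunc_logP (isT : 1 < 2) n0 => h.
apply: leq_trans (_ : 2 * n <= _); first by rewrite leq_mul2l h.
by rewrite expnS expn1 leq_mul2r n_gt1 orbT.
Qed.

(** [nlist] is at most twice the binary logarithm of [4 * n * n]. *)
Lemma nlist_le_bits r Delta : nlist n r Delta <= 8 * bits n.
Proof.
set L := bits n; have L1 : 0 < L by [].
have hn : n < 2 ^ L by exact: trunc_log_ltn.
have hlog : up_log 2 (4 * n * n) <= 2 * L + 2.
  apply: up_log_min => //.
  have -> : 2 ^ (2 * L + 2) = 4 * (2 ^ L * 2 ^ L) by rewrite mul2n -addnn !expnD mulnC.
  by rewrite -mulnA leq_mul2l /= leq_mul // ltnW.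
apply: leq_trans (_ : 2 ^ texp n <= _).
  by rewrite /nlist leq_exp2l // /aexp geq_minr.
rewrite /texp; set y := up_log 2 _ in hlog *.
have y1 : 1 < y.
  rewrite /y ltnNge; apply/negP => h.
  have := up_logP (4 * n * n) (isT : 1 < 2); rewrite leqNgt => /negP; apply.
  apply: leq_ltn_trans (_ : 2 ^ 1 < _); first by rewrite leq_exp2l.
  by rewrite expn1; nia.
have := up_log_gtn (isT : 1 < 2) y1; have : 0 < up_log 2 y by rewrite up_log_gt0.
by case: (up_log 2 y) => //= z _ hz; rewrite expnS; lia.
Qed.

Lemma two_pow_nlist r Delta : 2 ^ nlist n r Delta <= n ^ 16.
Proof.
apply: leq_trans (_ : 2 ^ (8 * bits n) <= _); first by rewrite leq_exp2l ?nlist_le_bits.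
by rewrite mulnC expnM -[16]/(2 * 8) expnM leq_exp2r // bits_pow.
Qed.

Lemma nlist_pow r Delta : nlist n r Delta <= n ^ 16.
Proof. exact: leq_trans (ltnW (ltn_expl _ (isT : 1 < 2))) (two_pow_nlist r Delta). Qed.

Lemma cap_le r Delta : cap n r Delta <= nlist n r Delta ^ r.-1.
Proof. exact: leq_div. Qed.

Lemma binomial_le m j : binomial m j <= m ^ j.
Proof.
elim: j => [|j IH]; first by rewrite bin0.
apply: leq_trans (_ : j.+1 * 'C(m, j.+1) <= _); first by rewrite leq_pmull.
by rewrite mul_bin_left expnS leq_mul // leq_subr.
Qed.

Lemma degree_pow r k Delta :
  Delta <= maxn 1 (\sum_(r <= q < k.+1) binomial n.-1 q.-1) ->
  Delta <= n ^ (k.+1 + k).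
Proof.
move=> h; have n0 : 0 < n by lia.
apply: leq_trans h _; rewrite geq_max expn_gt0 n0 /=.
apply: leq_trans (_ : \sum_(r <= q < k.+1) n ^ k <= _).
  rewrite !big_nat; apply: leq_sum => q /andP[_ qk].
  apply: leq_trans (binomial_le _ _) _.
  apply: leq_trans (_ : n ^ q.-1 <= _); last by rewrite leq_pexp2l //; lia.
  by case: (q.-1) => // j; rewrite leq_exp2r // leq_pred.
rewrite sum_nat_const_nat; apply: pow_mul => //.
by apply: leq_trans (leq_subr _ _) (pow_const _).
Qed.
End Growth.

Section Bounds.
Local Open Scope nat_scope.
Variables (r k : nat).
Hypothesis r_ge2 : 1 < r.

Lemma palette_pow : exists E, forall n Delta, 1 < n -> 0 < Delta ->
  Delta <= n ^ (k.+1 + k) -> 2 ^ mexp r Delta <= n ^ E.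
Proof.
eexists => n Delta n1 D0 hD; apply: leq_trans (_ : (2 ^ mexp r Delta) ^ r.-1 <= _).
  by rewrite -{1}(expn1 (2 ^ _)) leq_pexp2l ?expn_gt0 //; lia.
apply: leq_trans (ltnW (palette_small r_ge2 D0)) _.
apply: pow_mul; last by apply: pow_mul hD; apply: pow_const.
exact: pow_const.
Qed.

Lemma peak_pow : exists E, forall n Delta, 1 < n -> 0 < Delta ->
  Delta <= n ^ (k.+1 + k) -> peak n r k Delta <= n ^ E.
Proof.
have [E0 hE0] := palette_pow; eexists => n Delta n1 D0 hD; rewrite /peak.
have hn : n <= n ^ 1 by [].
have hl := nlist_pow n1 r Delta.
have hcap := leq_trans (cap_le n r Delta) (pow_exp r.-1 hl).
have h1 := pow_add n1 (hE0 n Delta n1 D0 hD) (two_pow_nlist n1 r Delta).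
have h2 := pow_add n1 (pow_add n1 h1 hcap) (pow_mul (pow_mul hn hl) (pow_succ n1 hcap)).
have h3 := pow_add n1 (pow_add n1 h2 (pow_mul (pow_const n1 10) hn)) hD.
exact (pow_add n1 (pow_add n1 (pow_add n1 h3 (pow_const n1 r)) (pow_const n1 k)) (pow_const n1 4)).
Qed.

Lemma post_steps_pow : exists E, forall n Delta, 1 < n ->
  post_steps n r Delta <= n ^ E.
Proof.
eexists => n Delta n1; rewrite /post_steps.
have hn : n <= n ^ 1 by [].
have hl := nlist_pow n1 r Delta.
have hcap := leq_trans (cap_le n r Delta) (pow_exp r.-1 hl).
have ha : aexp n r Delta <= n ^ 16.
  exact: leq_trans (ltnW (ltn_expl _ (isT : 1 < 2))) hl.
have h10 := pow_const n1 10; have h30 := pow_const n1 30.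
have h1 := pow_add n1 (pow_mul hn (pow_const n1 2)) h10.
have h2 := pow_add n1 (pow_mul (pow_const n1 8) ha) (pow_const n1 20).
have h3 := pow_mul (pow_mul hn (pow_mul hl hcap)) (pow_const n1 (2 * r + 20)).
have h4 := pow_succ n1 (pow_add n1 (pow_add n1 (pow_add n1 h1 h2) h3) h30).
have h5 := pow_add n1 (pow_mul (pow_mul h10 hn) h4) h10.
exact (pow_add n1 (pow_add n1 h5 (pow_add n1 (pow_mul hn h10) h10)) (pow_const n1 1)).
Qed.

Lemma space_bits (K : nat) : exists C, forall n Delta, 1 < n -> 0 < Delta ->
  Delta <= n ^ (k.+1 + k) ->
  (cells n r Delta + k + K) * bits (peak n r k Delta) <= C * n * bits n ^ r.+1.
Proof.
have [E hE] := peak_pow.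
exists ((16 + (r + 4) * 2 + k + K) * 8 ^ r * E.+1) => n Delta n1 D0 hD.
have hbits : bits (peak n r k Delta) <= E.+1 * bits n := bits_exp (hE n Delta n1 D0 hD).
have hl := nlist_le_bits n1 r Delta; set L := bits n in hl hbits *.
have hcells : cells n r Delta + k + K <= (16 + (r + 4) * 2 + k + K) * (n * (8 * L) ^ r).
  have l0 := nlist_gt0 n r Delta.
  have hc := cap_le n r Delta; rewrite /cells.
  set l := nlist n r Delta in hl l0 hc *.
  have w0 : 0 < n * (8 * L) ^ r by rewrite muln_gt0 expn_gt0 muln_gt0 /= andbT; lia.
  have w1 : n * l * (cap n r Delta).+1 <= 2 * (n * (8 * L) ^ r).
    apply: leq_trans (_ : n * l * (2 * l ^ r.-1) <= _).
      rewrite leq_mul2l; apply/orP; right.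
      have : 0 < l ^ r.-1 by rewrite expn_gt0 l0.
      lia.
    have -> : n * l * (2 * l ^ r.-1) = 2 * (n * l ^ r).
      by rewrite -[r in RHS](prednK (ltnW r_ge2)) expnS; lia.
    by rewrite !leq_mul2l leq_exp2r ?hl ?orbT //; lia.
  move: w0 w1; move: (n * _ * _.+1) (n * _) => x w w0 w1.
  have : (r + 4) * x <= (r + 4) * 2 * w by rewrite -mulnA leq_mul2l w1 orbT.
  move: ((r + 4) * x) ((r + 4) * 2) => y z hy; rewrite !mulnDl.
  have : k <= k * w by rewrite leq_pmulr.
  have : K <= K * w by rewrite leq_pmulr.
  lia.
apply: leq_trans (leq_mul hcells hbits) _.
rewrite expnMn [bits n ^ r.+1]expnS -/L.
by rewrite leq_eqVlt; apply/orP; left; apply/eqP; ring.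
Qed.

Lemma bits_le_self x : 0 < x -> bits x <= x.
Proof.
by move=> x0; apply: leq_trans (ltn_expl _ (isT : 1 < 2)) (trunc_logP _ x0).
Qed.

Lemma post_bits (K : nat) : exists E, forall n Delta, 1 < n -> 0 < Delta ->
  Delta <= n ^ (k.+1 + k) ->
  post_steps n r Delta * (K * bits (peak n r k Delta)).+1 <= n ^ E.
Proof.
have [E1 h1] := peak_pow; have [E2 h2] := post_steps_pow.
eexists => n Delta n1 D0 hD; apply: pow_mul (h2 n Delta n1) _.
apply: pow_succ => //; apply: pow_mul; first exact: pow_const.
by apply: leq_trans (bits_le_self _) (h1 _ _ n1 D0 hD); rewrite /peak; lia.
Qed.
End Bounds.

Section RealBounds.
Variable R : realType.

Lemma bits_ln n : (1 < n)%N -> (bits n)%:R <= 2 / ln 2 * ln n%:R :> R.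
Proof.
move=> n1; have ln2 : 0 < ln 2 :> R by rewrite ln_gt0 // ltr1n.
have lnn m : (0 < m)%N -> (m <= n)%N -> ln m%:R <= ln n%:R :> R.
  move=> m0 mn; rewrite ler_ln ?posrE ?ltr0n ?ler_nat //.
  exact: leq_trans mn.
rewrite mulrAC ler_pdivlMr // /bits -natr1.
have h2 := lnn 2%N isT n1.
have h : (trunc_log 2 n)%:R * ln 2 <= ln n%:R :> R.
  rewrite mulr_natl -lnXn // -natrX; apply: lnn; first by rewrite expn_gt0.
  by apply: trunc_logP => //; lia.
lra.
Qed.

Lemma palette_le (r Delta : nat) : (1 < r)%N -> (0 < Delta)%N ->
  (2 ^ mexp r Delta)%:R <= (2 ^ (r + 19))%:R * Delta%:R `^ (r.-1%:R^-1) :> R.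
Proof.
move=> r2 D0; have p0 : (0 < r.-1)%N by lia.
have root (x : nat) : (x%:R : R) = ((x ^ r.-1)%:R : R) `^ (r.-1%:R^-1).
  by rewrite natrX -powR_mulrn // -powRrM divff ?powRr1 // pnatr_eq0 -lt0n.
have hnat : ((2 ^ mexp r Delta) ^ r.-1 <= (2 ^ (r + 19)) ^ r.-1 * Delta)%N.
  apply: leq_trans (ltnW (palette_small r2 D0)) _.
  rewrite mulnA leq_mul2r; apply/orP; right.
  rewrite (_ : r + 19 = (r + 18).+1)%N; last by lia.
  rewrite [in leqRHS]expnS expnMn leq_mul2l; apply/orP; right.
  by rewrite -[leqLHS]expn1 leq_pexp2l ?expn_gt0.
rewrite [in leLHS]root [in X in _ <= X * _]root -powRM //.
apply: ge0_ler_powR; rewrite ?nnegrE //.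
by rewrite -natrM ler_nat.
Qed.
End RealBounds.

(** * The colors output, and their probability of being proper *)

Section Colors.
Local Open Scope nat_scope.
Variables (n r k Delta : nat).
Hypothesis r_ge2 : 1 < r.
Hypothesis n_gt1 : 1 < n.
Variables (H : {set {set 'I_n}}) (es : seq (seq 'I_n)).
Hypothesis H_sizes : forall e, e \in H -> r <= #|e| <= k.
Hypothesis H_degree : max_degree H <= Delta.
Hypothesis es_stream : stream_of H es.

Lemma stream_edges e : e \in es -> [&& uniq e, r <= size e & size e <= k].
Proof.
move=> ein; have /andP[/allP us /perm_mem pe] := es_stream.
have eH : [set:: e]%SET \in H.
  by rewrite -mem_enum -pe; apply: map_f.
have ue := us e ein; rewrite ue /=.
by have := H_sizes eH; rewrite cardsE (card_uniqP ue).
Qed.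

Lemma stream_degree v : count (fun e => v \in e) es <= Delta.
Proof.
have /andP[_ pe] := es_stream.
apply: leq_trans (leq_trans (_ : _ <= degree H v) (_ : _ <= max_degree H)) H_degree; last first.
  exact: (leq_bigmax v).
have -> : count (fun e => v \in e) es =
    count (fun A : {set 'I_n} => v \in A) [seq [set:: e]%SET | e <- es].
  by rewrite count_map; apply: eq_count => e; rewrite /= inE.
rewrite (permP pe) -size_filter /degree cardE.
apply: uniq_leq_size; first by rewrite filter_uniq ?enum_uniq.
by move=> A; rewrite mem_filter !mem_enum inE andbC.
Qed.

Definition colors (coin : nat -> bool) : seq nat :=
  let X := @coin_table n r Delta coin in
  [seq color X (@final n r Delta es X (@coin_choices n r Delta coin)) v
  | v <- enum 'I_n].

Definition good_colors (out : seq nat) :=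
  [/\ size out = n, forall v : 'I_n, nth 0 out v < 2 ^ mexp r Delta &
      proper_coloring H (fun v : 'I_n => nth 0 out v)].

Notation run_at := (stream_run (coloring_algorithm r) r k Delta es).

Lemma halted_stays A coin c t : halted c -> iter t (step A coin) c = c.
Proof.
move=> h; elim: t => //= t ->.
by case: c h => [cd p fut ed m nc o] /andP[/= pp /nilP ->]; rewrite /step /= pp.
Qed.

(** Once halted a run does not move, so whether some configuration outputs a proper
    coloring is decided by [colors coin], which depends on finitely many coins. *)
Lemma outputs_coloringP coin :
  (exists t, outputs_coloring H (2 ^ mexp r Delta) (run_at coin t)) <->
  good_colors (colors coin).
Proof.
have es_ok' e : e \in es -> [&& uniq e, r <= size e & size e <= k].
  exact: stream_edges.
have [_ [t0 [t1 [_ _ hh ho]]]] :=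
  stream_run_spec coin r_ge2 n_gt1 es_ok' stream_degree.
split; last by move=> [g1 g2 g3]; exists (t0 + t1); split; rewrite ?ho.
case=> t [ht g1 g2 g3].
suff E : output (run_at coin t) = colors coin by rewrite -E.
rewrite /colors -ho; case: (leqP t (t0 + t1)) => le.
  by rewrite -(subnK le) /stream_run /run iterD (halted_stays _ _ _ ht).
by rewrite -(subnK (ltnW le)) /stream_run /run iterD (halted_stays _ _ _ hh).
Qed.

Lemma lucky_good coin : @lucky n r Delta es coin -> good_colors (colors coin).
Proof.
move=> /eqP full.
have nthE (v : 'I_n) : nth 0 (colors coin) v = color (@coin_table n r Delta coin)
    (@final n r Delta es (@coin_table n r Delta coin) (@coin_choices n r Delta coin)) v.
  by rewrite (nth_map v) ?size_enum_ord // nth_ord_enum.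
have Xlt j v : @coin_table n r Delta coin j v < nbase n r Delta by exact: digit_lt.
split; first by rewrite size_map size_enum_ord.
  by move=> v; rewrite nthE; exact: color_lt.
move=> A AH [c mono].
have /andP[_ /perm_mem pe] := es_stream.
have : A \in enum H by rewrite mem_enum.
rewrite -pe => /mapP[e ein AE].
have es_ok' e' : e' \in es -> uniq e' && (r <= size e').
  by move=> /stream_edges /and3P[-> ->].
apply: (color_proper r_ge2 es_ok' Xlt full ein).
by exists c => v ve; rewrite -nthE; apply: mono; rewrite AE inE.
Qed.

Lemma colors_local coin coin' :
  (forall i, i < @ncoins n r Delta -> coin i = coin' i) ->
  colors coin = colors coin'.
Proof. by move=> /eq_coins[h1 h2]; rewrite /colors h1 h2. Qed.

Lemma steps_bounded coin (K := acost (coloring_algorithm r) * bits (peak n r k Delta)) :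
  exists t0 t1,
    [/\ forall t, t < t0 -> ~~ post (run_at coin t), t1 <= post_steps n r Delta,
        forall t, t0 + t1 <= t -> halted (run_at coin t) &
        forall t, step_time (run_at coin t) <= K.+1].
Proof.
have es_ok' e : e \in es -> [&& uniq e, r <= size e & size e <= k].
  exact: stream_edges.
have [hs [t0 [t1 [h1 h2 hh _]]]] :=
  stream_run_spec coin r_ge2 n_gt1 es_ok' stream_degree.
exists t0, t1; split=> // [t le|t].
  by rewrite -(subnK le) /stream_run /run iterD (halted_stays _ _ _ hh).
rewrite /step_time; case: ifP => // _; rewrite ltnS.
apply: scratch_le (hs t); first exact: peak_gt1.
apply: stream_fits => //.
Qed.

Lemma space_bounded coin t :
  space_used (run_at coin t) <=
    (cells n r Delta + k + acost (coloring_algorithm r)) * bits (peak n r k Delta).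
Proof.
have es_ok' e : e \in es -> [&& uniq e, r <= size e & size e <= k].
  exact: stream_edges.
have [hs _] := stream_run_spec coin r_ge2 n_gt1 es_ok' stream_degree.
apply: space_le (hs t); first exact: peak_gt1.
exact: stream_fits.
Qed.
End Colors.

Theorem corollary2 (R : realType) (r k : nat) (hr : (2 <= r)%N)
    (hrk : (r <= k)%N) :
  exists (A : algorithm) (c Ccol Csp Ct : R) (psp pt : nat),
    0 < c /\
    forall n Delta : nat,
      (2 <= n)%N ->
      (1 <= Delta <=
         maxn 1 (\sum_(r <= q < k.+1) binomial n.-1 q.-1)%N)%N ->
      exists q : nat,
        q%:R <= Ccol * Delta%:R `^ (r.-1%:R^-1) /\
        forall (H : {set {set 'I_n}}) (s : seq (seq 'I_n)),
          (forall e, e \in H -> (r <= #|e| <= k)%N) ->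
          (max_degree H <= Delta)%N ->
          stream_of H s ->
          (forall (coin : nat -> bool) (t : nat),
             (space_used (stream_run A r k Delta s coin t))%:R
               <= Csp * n%:R * ln n%:R ^+ psp) /\
          (forall (d : measure_display) (T : measurableType d)
                  (P : probability T R) (coin : nat -> T -> bool),
             fair_coins P coin ->
             ((1 - n%:R `^ (- c))%:E <=
                P [set w | exists t : nat,
                     outputs_coloring H q
                       (stream_run A r k Delta s (coin^~ w) t)]%classic)%E /\
             (\int[P]_w post_time R (stream_run A r k Delta s (coin^~ w))
                <= (Ct * n%:R ^+ pt)%:E)%E).
Proof.
pose A := coloring_algorithm r.
have [C hC] := space_bits k hr (acost A).
have [E hE] := post_bits k hr (acost A).
exists A, 1, (2 ^ (r + 19))%:R, (C%:R * (2 / ln 2) ^+ r.+1), 1, r.+1, E.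
split=> // n Delta n2 /andP[D0 hD]; have hD' := degree_pow n2 hD.
exists (2 ^ mexp r Delta)%N; split; first exact: palette_le.
move=> H s sizes maxdeg hs.
have n0 : (0 < n)%N by exact: ltnW.
split=> [coin t|d T P coin fair].
  have h1 := leq_trans (space_bounded hr n2 sizes maxdeg hs coin t) (hC n Delta n2 D0 hD').
  rewrite -(ler_nat R) in h1; apply: le_trans h1 _.
  rewrite natrM natrM natrX -!mulrA ler_wpM2l // mulrCA mulrC.
  rewrite [leRHS]mulrC ler_wpM2r //  -exprMn.
  by rewrite lerXn2r ?nnegrE ?bits_ln // (le_trans _ (bits_ln R n2)).
split; last first.
  have hb w : (0 <= post_time R (stream_run A r k Delta s (coin^~ w)) <=
      (1 * n%:R ^+ E)%:E)%E.
    have [t0 [t1 [g1 g2 g3 g4]]] := steps_bounded hr n2 sizes maxdeg hs (coin^~ w).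
    have /andP[-> h] := post_time_le R g1 g3 g4; apply: le_trans h _.
    rewrite lee_fin mul1r -natrX ler_nat.
    by apply: leq_trans (hE n Delta n2 D0 hD'); rewrite leq_mul2r g2 orbT.
  by apply: expectation_le_bound => w; have /andP[] := hb w.
pose G c := `[< good_colors r Delta H (colors r Delta s c) >].
have Glocal c c' : (forall i, (i < @ncoins n r Delta)%N -> c i = c' i) -> G c = G c'.
  by move=> /(colors_local s) h; rewrite /G h.
have [mG PG] := fair_coins_event fair Glocal.
have -> : [set w | exists t : nat, outputs_coloring H (2 ^ mexp r Delta)%N
    (stream_run A r k Delta s (coin^~ w) t)]%classic = [set w | G (coin^~ w)]%classic.
  apply/seteqP; split=> w /=.
    by move/(outputs_coloringP hr n2 sizes maxdeg hs) => g; apply/asboolP.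
  by move/asboolP => g; apply/(outputs_coloringP hr n2 sizes maxdeg hs).
rewrite PG lee_fin powR_inv1 //.
set m := ncoins n r Delta.
have es_ok e : e \in s -> uniq e && (r <= size e)%N.
  by move=> /(stream_edges sizes hs) /and3P[-> ->].
pose g := #|[pred t : m.-tuple bool | G (nth false t)]|.
pose u := #|[pred t : m.-tuple bool | ~~ lucky r Delta s (nth false t)]|.
have bad : (u * n <= 2 ^ m)%N.
  exact: unlucky_rare hr n2 es_ok (stream_degree maxdeg hs).
have total : (2 ^ m <= g + u)%N.
  have <- : #|{: m.-tuple bool}| = (2 ^ m)%N by rewrite card_tuple card_bool.
  rewrite -cardUI; apply: leq_trans (leq_addr _ _); apply: subset_leq_card.
  apply/fintype.subsetP => t _; rewrite !inE; case: (boolP (lucky _ _ _ _)) => ht; last by rewrite orbT.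
  by rewrite orbF; apply/asboolP; exact: (lucky_good hr sizes hs ht).
have p0 : 0 < 2%:R ^+ m :> R by rewrite exprn_gt0.
have nR : 0 < n%:R :> R by rewrite ltr0n.
rewrite -/g exprVn ler_pdivlMr // mulrBl mul1r lerBlDr.
have h1 : 2%:R ^+ m <= g%:R + u%:R :> R by rewrite -natrX -natrD ler_nat.
have h2 : u%:R <= n%:R^-1 * 2%:R ^+ m :> R.
  by rewrite mulrC ler_pdivlMr // -natrX -natrM ler_nat.
by apply: le_trans h1 _; rewrite lerD2l.
Qed.
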